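(* Let $\Omega=\bigcup_{i=1}^nJ_i$, $J_i=(\alpha_i,\beta_i)$, with $-\infty<\alpha_1<\beta_1<\alpha_2<\beta_2<\dots<\alpha_n<\beta_n<\infty$. Let $A$ be a self-adjoint extension of the operator $\mathsf{D}=\frac1{2\pi \mathrm{i}}\frac{d}{dx}$ on $C_c^\infty(\Omega)$, and let $B$ be the $n\times n$ unitary matrix associated to $A$. Let $P$ be the spectral measure of $A$, $A=\int_{\mathbb{R}}t\,dP(t)$. Then $P$ is atomic, supported on the set $$\Lambda_B:=\{\lambda\in\mathbb{C}:\det(I-E(-2\pi \mathrm{i}\lambda\beta)BE(2\pi \mathrm{i}\lambda\alpha))=0\},$$ which is also the spectrum $\sigma(A)$ of $A$. For $\lambda\in\Lambda_B$, the eigenspace $P(\lambda)L^2(\Omega)$ is finite dimensional and $$P(\lambda)L^2(\Omega)=\left\{\sum_{i=1}^nc_i\chi_{J_i}(t)e^{2\pi \mathrm{i}\lambda t}: c=(c_1,\dots,c_n)^t\in\mathbb{C}^n,\ (I-E(-2\pi \mathrm{i}\lambda\beta)BE(2\pi \mathrm{i}\lambda\alpha))c=0\right\}.$$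
   Context: The Hilbert space is $L^2(\Omega)$. The adjoint $\mathsf{D}^*$ has domain $\mathcal{D}_{\max}=\{f\in L^2(\Omega): f\text{ absolutely continuous on each }J_i,\ f'\in L^2(\Omega)\}$ and $\mathsf{D}^*f=\frac1{2\pi \mathrm{i}}f'$. For $f\in\mathcal{D}_{\max}$, $f(\alpha)=(f(\alpha_i))_{i=1}^n$ and $f(\beta)=(f(\beta_i))_{i=1}^n$ are the vectors of one-sided limits at the endpoints from inside $J_i$. Every self-adjoint extension $A$ of $\mathsf{D}$ is the restriction of $\mathsf{D}^*$ to $\mathcal{D}_B=\{f\in\mathcal{D}_{\max}:Bf(\alpha)=f(\beta)\}$ for a unique $n\times n$ unitary matrix $B$, called the matrix associated to $A$. For $v\in\mathbb{C}^n$, $E(v)$ is the diagonal matrix with entries $e^{v_1},\dots,e^{v_n}$; $\alpha=(\alpha_1,\dots,\alpha_n)$, $\beta=(\beta_1,\dots,\beta_n)$. $P(\lambda)=P(\{\lambda\})$. *)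

(* Defs.v *)
From HB Require Import structures.
From mathcomp Require Import all_boot all_order all_algebra.
From mathcomp Require Import generic_quotient ring_quotient.
From mathcomp Require Import all_classical all_reals all_analysis.

Set Implicit Arguments.
Unset Strict Implicit.
Unset Printing Implicit Defensive.

Import Order.TTheory GRing.Theory Num.Theory.
Import numFieldNormedType.Exports.
(* Last, so that [Re] and [Im] are the projections of [R[i]]. *)
From mathcomp Require Import complex.

Local Open Scope classical_set_scope.
Local Open Scope ring_scope.
Local Open Scope complex_scope.

Section L2.
Context d (T : measurableType d) (R : realType).
Variable mu : {measure set T -> \bar R}.

(* The library's [Lfun] is real-valued: a complex function is square
   integrable iff its real and imaginary parts are. *)
Definition L2pred : {pred T -> R[i]} :=
  [pred f | ((fun x => Re (f x)) \in Lfun mu 2%:E)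
         && ((fun x => Im (f x)) \in Lfun mu 2%:E)].

Lemma L2pred_submod_closed : submod_closed L2pred.
Proof.
have S := Lfun_submod_closed mu (lee1n 2).
have Z (a : R) f : f \in Lfun mu 2%:E -> (fun x => a * f x) \in Lfun mu 2%:E.
  move=> fL; rewrite (_ : (fun _ => _) = a *: f + 0); first exact/S.2/S.1.
  by apply/funext => x /=; rewrite addr0.
have A f g : f \in Lfun mu 2%:E -> g \in Lfun mu 2%:E ->
    (fun x => f x + g x) \in Lfun mu 2%:E.
  move=> fL gL; rewrite (_ : (fun _ => _) = 1 *: f + g); first exact/S.2.
  by apply/funext => x /=; rewrite scale1r.
split; first by apply/andP; split; exact: S.1.
move=> a f g /andP[f1 f2] /andP[g1 g2]; apply/andP; split.
- rewrite (_ : (fun _ => _) = fun x =>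
    (Re a * Re (f x) + (- Im a) * Im (f x)) + Re (g x)); last first.
    apply/funext => x /=; rewrite mulNr.
    rewrite -[(a *: f + g) x]/(a * f x + g x).
    by case: a (f x) (g x) => [? ?] [? ?] [? ?].
  by apply/A => //; apply/A; exact: Z.
- rewrite (_ : (fun _ => _) = fun x =>
    (Re a * Im (f x) + Im a * Re (f x)) + Im (g x)); last first.
    apply/funext => x; rewrite -[(a *: f + g) x]/(a * f x + g x).
    by case: a (f x) (g x) => [? ?] [? ?] [? ?].
  by apply/A => //; apply/A; exact: Z.
Qed.

HB.instance Definition _ :=
  GRing.isSubmodClosed.Build R[i] (T -> R[i]) L2pred L2pred_submod_closed.

Record L2fun := MkL2fun { L2fun_val :> T -> R[i] ; _ : L2fun_val \in L2pred }.

HB.instance Definition _ := [isSub for L2fun_val].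
HB.instance Definition _ := [Choice of L2fun by <:].
HB.instance Definition _ := [SubChoice_isSubLmodule of L2fun by <:].

Definition L2null : {pred L2fun} :=
  [pred f : L2fun | `[< {ae mu, forall x, f x = 0} >]].

Lemma L2null_submod_closed : submod_closed L2null.
Proof.
split; first by apply/asboolP; exact: aeW.
move=> a f g /asboolP f0 /asboolP g0; apply/asboolP.
apply: filterS2 f0 g0 => x f0 g0.
by rewrite -[LHS]/(a * f x + g x) f0 g0 mulr0 addr0.
Qed.

HB.instance Definition _ :=
  GRing.isSubmodClosed.Build R[i] L2fun L2null L2null_submod_closed.

Local Open Scope quotient_scope.

Definition L2 : Type := Quotient.quot L2null.
HB.instance Definition _ := GRing.Zmodule.on L2.
HB.instance Definition _ := EqQuotient.on L2.

Definition L2scale (a : R[i]) : L2 -> L2 := fun u => \pi_L2 (a *: (repr u : L2fun)).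

Lemma L2scale_pi a (f : L2fun) : L2scale a (\pi_L2 f) = \pi_L2 (a *: f).
Proof.
rewrite /L2scale; apply/eqP; rewrite -Quotient.idealrBE -scalerBr.
by apply: rpredZ; rewrite Quotient.idealrBE reprK.
Qed.

Lemma L2pi_add (f g : L2fun) : \pi_L2 f + \pi_L2 g = \pi_L2 (f + g).
Proof. exact/esym/Quotient.pi_add. Qed.

Fact L2scaleA a b v : L2scale a (L2scale b v) = L2scale (a * b) v.
Proof. by rewrite -[v]reprK !L2scale_pi reprK scalerA. Qed.
Fact L2scale1 : left_id 1 L2scale.
Proof. by move=> v; rewrite -[v]reprK L2scale_pi scale1r. Qed.
Fact L2scaleDr : right_distributive L2scale +%R.
Proof.
move=> a u v; rewrite -[u]reprK -[v]reprK L2pi_add !L2scale_pi L2pi_add.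
by rewrite scalerDr.
Qed.
Fact L2scaleDl v : {morph L2scale^~ v : a b / a + b}.
Proof. by move=> a b; rewrite -[v]reprK !L2scale_pi L2pi_add scalerDl. Qed.

HB.instance Definition _ :=
  GRing.Zmodule_isLmodule.Build R[i] L2 L2scaleA L2scale1 L2scaleDr L2scaleDl.

End L2.

Section L2_functions.
Context d (T : measurableType d) (R : realType).
Variable mu : {measure set T -> \bar R}.

Definition is_class_of (u : L2 mu) (f : T -> R[i]) : Prop :=
  {ae mu, forall x, repr u x = f x}.

Definition L2ip (u v : L2 mu) : R[i] :=
  let w x := repr u x * (repr v x)^* in
  (\int[mu]_x Re (w x)) +i* (\int[mu]_x Im (w x)).

End L2_functions.

Arguments L2ip {d T R mu}.

(* Operators are given by their graphs. The scalar product [ip] is linear in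
   its first argument. *)
Section Operators.
Context (R : realType) (H : lmodType R[i]).
Variable ip : H -> H -> R[i].
Implicit Types (A : set (H * H)) (D : set H) (P : set R -> H -> H).

Definition hnorm (u : H) : R := Num.sqrt (Re (ip u u)).

Definition dom A : set H := [set u | exists v, A (u, v)].

Definition linear_operator A :=
  [/\ A (0, 0),
      forall a u v u' v', A (u, v) -> A (u', v') ->
        A (a *: u + u', a *: v + v')
    & forall u v v', A (u, v) -> A (u, v') -> v = v'].

Definition dense_set D := forall (u : H) (e : R), 0 < e ->
  exists2 v, D v & hnorm (u - v) < e.

Definition adjoint A : set (H * H) :=
  [set p | forall u v, A (u, v) -> ip v p.1 = ip u p.2].

Definition restriction A D : set (H * H) := [set p | A p /\ D p.1].

Definition self_adjoint A :=
  [/\ linear_operator A, dense_set (dom A) & adjoint A = A].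

Definition self_adjoint_extension A A' := self_adjoint A' /\ A `<=` A'.

Definition resolvent_set A : set R[i] := [set l |
  (forall w, exists! u, exists2 v, A (u, v) & v - l *: u = w) /\
  (exists M : R, forall u v, A (u, v) -> hnorm u <= M * hnorm (v - l *: u))].

Definition spectrum A : set R[i] := ~` resolvent_set A.

Definition orthogonal_projection (E : H -> H) :=
  [/\ forall a u v, E (a *: u + v) = a *: E u + E v,
      forall u, E (E u) = E u
    & forall u v, ip (E u) v = ip u (E v)].

(* Only the values of [P] at Borel sets matter. *)
Record projection_valued_measure P : Prop := {
  pvm_proj : forall S, measurable S -> orthogonal_projection (P S) ;
  pvm_set0 : forall u, P set0 u = 0 ;
  pvm_setT : forall u, P setT u = u ;
  pvm_setI : forall S S' u, measurable S -> measurable S' ->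
    P (S `&` S') u = P S (P S' u) ;
  pvm_bigcup : forall (F : (set R)^nat) u,
    (forall k, measurable (F k)) -> trivIset setT F ->
    hnorm (\sum_(k < N) P (F k) u - P (\bigcup_k F k) u) @[N --> \oo] --> (0 : R)
}.

Definition scalar_measure P (u : H) : set R -> \bar R :=
  fun S => (Re (ip (P S u) u))%:E.

(* [A = \int t dP(t)]: the domain is the set of the [u] such that
   [\int t^2 d<P(t)u, u>] is finite, and [<Au, u> = \int t d<P(t)u, u>]
   there, which determines [A] by polarization. *)
Definition spectral_measure_of A P :=
  [/\ projection_valued_measure P,
      dom A = [set u |
        (\int[scalar_measure P u]_t (t ^+ 2)%:E < +oo)%E]
    & forall u v, A (u, v) ->
        ip v u = (fine (\int[scalar_measure P u]_t t%:E))%:C].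

(* The set of atoms is countable and carries the whole of [P]. *)
Definition atomic P :=
  let atoms := [set t : R | exists u, P [set t] u <> 0] in
  countable atoms /\ forall u, P (~` atoms) u = 0.

Definition supported_on P (L : set R[i]) :=
  let S := [set t : R | L t%:C] in
  measurable S /\ forall u, P (~` S) u = 0.

Definition finite_dimensional (V : set H) :=
  exists (m : nat) (e : 'I_m -> H),
    V = [set u | exists c : 'I_m -> R[i], u = \sum_k c k *: e k].

End Operators.

Section Functions.
Context (R : realType).
Implicit Types (f : R -> R[i]) (J W : set R).

Definition cexp (z : R[i]) : R[i] :=
  (expR (Re z))%:C * (cos (Im z) +i* sin (Im z)).

Definition twopii : R[i] := (2 * pi)%:C * 'i.

Definition cderivable f (x : R) :=
  derivable (fun t => Re (f t)) x 1 /\ derivable (fun t => Im (f t)) x 1.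

Definition cderive f (x : R) : R[i] :=
  derive1 (fun t => Re (f t)) x +i* derive1 (fun t => Im (f t)) x.

Definition ccvg f (F : set_system R) (z : R[i]) :=
  ((fun t => Re (f t)) @ F --> Re z) /\ ((fun t => Im (f t)) @ F --> Im z).

Definition smooth f := forall k x,
  derivable (derive1n k (fun t => Re (f t))) x 1 /\
  derivable (derive1n k (fun t => Im (f t))) x 1.

(* Elements of [C_c^\infty(W)] are extended by zero to the whole line. *)
Definition test_function W f := smooth f /\
  exists K, [/\ compact K, K `<=` W & forall x, ~ K x -> f x = 0].

Definition absolutely_continuous J f := forall e : R, 0 < e ->
  exists2 d : R, 0 < d & forall m (a b : 'I_m -> R),
    (forall k, a k <= b k) ->
    (forall k, `[a k, b k]%classic `<=` J) ->
    trivIset setT (fun k => `]a k, b k[%classic) ->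
    \sum_k (b k - a k) < d ->
    \sum_k ComplexField.Normc.normc (f (b k) - f (a k)) < e.

End Functions.

Arguments twopii {R}.

Section Intervals.
Context (R : realType) (n : nat).
Variables alpha beta : 'I_n -> R.

Definition J (i : 'I_n) : set R := `]alpha i, beta i[%classic.

Definition Omega : set R := \bigcup_i J i.

Lemma measurable_Omega : measurable Omega.
Proof. by apply: fin_bigcup_measurable => // i _; exact: measurable_itv. Qed.

Definition mu_Omega : set (measurableTypeR R) -> \bar R :=
  mrestr lebesgue_measure measurable_Omega.
HB.instance Definition _ := Measure.on mu_Omega.

Definition L2Omega := L2 mu_Omega.

Definition opD : set (L2Omega * L2Omega) := [set p : L2Omega * L2Omega |
  exists2 f, test_function Omega f &
    is_class_of p.1 f /\ is_class_of p.2 (fun x => twopii^-1 * cderive f x)].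

(* [D_max] consists of the [u] that have such an [f]. Absolute continuity
   implies differentiability a.e.; it is restated because [cderive] takes
   junk values elsewhere. *)
Definition Dmax_repr (u : L2Omega) (f : R -> R[i]) :=
  [/\ is_class_of u f,
      forall i, absolutely_continuous (J i) f,
      {ae mu_Omega, forall x, cderivable f x}
    & exists v : L2Omega, is_class_of v (cderive f)].

Definition dom_B (B : 'M[R[i]]_n) : set L2Omega := [set u |
  exists f, Dmax_repr u f /\
  exists fa fb : 'cV[R[i]]_n,
    [/\ forall i, ccvg f ((alpha i)^'+) (fa i 0),
        forall i, ccvg f ((beta i)^'-) (fb i 0)
      & B *m fa = fb]].

Definition associated_matrix (A : set (L2Omega * L2Omega)) (B : 'M[R[i]]_n) :=
  B \is unitarymx /\ A = restriction (adjoint L2ip opD) (dom_B B).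

Definition Ediag (v : 'I_n -> R[i]) : 'M[R[i]]_n := diag_mx (\row_i cexp (v i)).

Definition Mlambda (B : 'M[R[i]]_n) (l : R[i]) : 'M[R[i]]_n :=
  1%:M - Ediag (fun i => - twopii * l * (beta i)%:C) *m B
         *m Ediag (fun i => twopii * l * (alpha i)%:C).

Definition Lambda_B (B : 'M[R[i]]_n) : set R[i] :=
  [set l | \det (Mlambda B l) = 0].

Definition exp_sum (l : R[i]) (c : 'cV[R[i]]_n) : R -> R[i] :=
  fun t => \sum_i c i 0 * (\1_(J i) t)%:C * cexp (twopii * l * t%:C).

End Intervals.

Arguments opD {R n} alpha beta.
Arguments associated_matrix {R n alpha beta} A B.
Arguments Mlambda {R n} alpha beta B l.
Arguments Lambda_B {R n} alpha beta B.
Arguments exp_sum {R n} alpha beta l c.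

(* Main.v *)
(* On each [J_i] the equation [u' / (2 pi i) - l u = f] has the solutions
   [e^(2 pi i l t) (c_i + 2 pi i \int_(alpha_i)^t e^(- 2 pi i l s) f(s) ds)], and
   the boundary condition becomes a linear system [Mlambda c = - k] in which [k]
   depends linearly on [f]. Outside [Lambda_B] it is solvable for every [f], and
   the solution operator is bounded; it inverts [A - l] on the domain of [A],
   hence everywhere by density. At a real [l] in [Lambda_B], [Mlambda] is the identity minus
   a unitary matrix, so by the Fredholm alternative the range of [A - l] contains
   every vector of the domain that is orthogonal to the exponential sums: hence
   these exhaust the eigenspace. Since the boundary form vanishes on kernel
   vectors of [Mlambda], [Lambda_B] is real, and rounding normalized kernel
   vectors shows that it is countable. Finally, the range of [P S] for a small
   interval [S] around [l] is close to an eigenspace of [A]; so [P] vanishes near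
   the real points of the resolvent set and [P {l}] projects onto the eigenspace
   of [l], and a countable spectrum makes [P] atomic. *)

Require Import Defs.
From HB Require Import structures.
From mathcomp Require Import all_boot all_order all_algebra.
From mathcomp Require Import all_classical all_reals all_analysis.
From mathcomp Require Import measurable_realfun ring lra.
Import Order.TTheory GRing.Theory Num.Theory.
Import numFieldNormedType.Exports.
From mathcomp Require Import complex.

Set Implicit Arguments.
Unset Strict Implicit.
Unset Printing Implicit Defensive.

Local Open Scope classical_set_scope.
Local Open Scope ring_scope.
Local Open Scope complex_scope.

Import ComplexField.Normc.

(** Two obstacles shape the proof. The spectral measure is tied to [A] only by the domain and the
    quadratic form, that is, by second and first moments of the scalar measures of [P]. That [P S]
    commutes with [A], and the estimate of [A - l] on the range of [P S], are therefore extracted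
    from these moments by polarization. The other obstacle is that a vector of the domain is an
    almost-everywhere class with an absolutely continuous representative. Integration by parts is
    done only for pieces that are [C^1] up to the endpoints. From a vector of the domain one takes a
    representative that is continuous on every closed interval; as a right-hand side it makes the
    Duhamel solution [C^1], and a [C^1] solution with the right boundary values lies in the graph.
    The resolvent equation is thus solved by formula for right-hand sides in the domain, and the
    hypothesis [adjoint A = A] carries it to all others. Orthogonality arguments rest on the density
    of the domain and on projections onto spans of finitely many vectors. *)

Section ComplexParts.
Context (R : rcfType).
Implicit Types z w : R[i].

Lemma conjE z : Num.conj z = (Re z) -i* (Im z).
Proof. by case: z. Qed.

Lemma complex_eq z w : Re z = Re w -> Im z = Im w -> z = w.
Proof. by case: z w => [a b] [c d] /= -> ->. Qed.

Lemma ReD z w : Re (z + w) = Re z + Re w. Proof. by case: z w => [? ?] [? ?]. Qed.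
Lemma ImD z w : Im (z + w) = Im z + Im w. Proof. by case: z w => [? ?] [? ?]. Qed.
Lemma ReN z : Re (- z) = - Re z. Proof. by case: z. Qed.
Lemma ImN z : Im (- z) = - Im z. Proof. by case: z. Qed.
Lemma ReM z w : Re (z * w) = Re z * Re w - Im z * Im w.
Proof. by case: z w => [? ?] [? ?]. Qed.
Lemma ImM z w : Im (z * w) = Re z * Im w + Im z * Re w.
Proof. by case: z w => [? ?] [? ?]. Qed.
Lemma ReJ z : Re (Num.conj z) = Re z. Proof. by case: z. Qed.
Lemma ImJ z : Im (Num.conj z) = - Im z. Proof. by case: z. Qed.

Definition ReIm := (ReD, ImD, ReN, ImN, ReM, ImM, ReJ, ImJ).

Lemma Re_sum I (r : seq I) (F : I -> R[i]) :
  Re (\sum_(i <- r) F i) = \sum_(i <- r) Re (F i).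
Proof. by apply: (big_morph _ ReD). Qed.
Lemma Im_sum I (r : seq I) (F : I -> R[i]) :
  Im (\sum_(i <- r) F i) = \sum_(i <- r) Im (F i).
Proof. by apply: (big_morph _ ImD). Qed.

Lemma normc_def2 z : (normc z) ^+ 2 = Re z ^+ 2 + Im z ^+ 2.
Proof. by case: z => a b /=; rewrite sqr_sqrtr// addr_ge0// sqr_ge0. Qed.

Lemma normc_ge0 z : 0 <= normc z.
Proof. by case: z => a b /=; exact: sqrtr_ge0. Qed.

Lemma Re_le_normc z : `|Re z| <= normc z.
Proof.
rewrite -(@ler_pXn2r _ 2)// ?nnegrE ?normc_ge0// normc_def2 real_normK ?num_real//.
by rewrite lerDl sqr_ge0.
Qed.

Lemma Im_le_normc z : `|Im z| <= normc z.
Proof.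
rewrite -(@ler_pXn2r _ 2)// ?nnegrE ?normc_ge0// normc_def2 real_normK ?num_real//.
by rewrite lerDr sqr_ge0.
Qed.

Lemma normc_le_ReIm z : normc z <= `|Re z| + `|Im z|.
Proof.
rewrite -(@ler_pXn2r _ 2)// ?nnegrE ?normc_ge0 ?addr_ge0// normc_def2.
rewrite sqrrD !real_normK ?num_real// lerD2r lerDl.
by rewrite mulrn_wge0// mulr_ge0.
Qed.

Lemma normcJ2 z : normc (Num.conj z) = normc z.
Proof. by case: z => a b /=; rewrite sqrrN. Qed.

End ComplexParts.

(** * Inner product spaces *)

Section PreHilbert.
Context (R : realType) (H : lmodType R[i]).

Record inner_product (ip : H -> H -> R[i]) : Prop := {
  ip_linear : forall a u v w, ip (a *: u + v) w = a * ip u w + ip v w ;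
  ip_conj : forall u v, ip v u = Num.conj (ip u v) ;
  ip_ge0 : forall u, 0 <= Re (ip u u) ;
  ip_eq0 : forall u, Re (ip u u) = 0 -> u = 0 }.

Variable ip : H -> H -> R[i].
Hypothesis hip : inner_product ip.
Implicit Types (u v w x y : H) (a b : R[i]).

Local Notation hnorm := (hnorm ip).

Lemma ipDl u v w : ip (u + v) w = ip u w + ip v w.
Proof. by rewrite -[u]scale1r (ip_linear hip) mul1r scale1r. Qed.
Lemma ip0l w : ip 0 w = 0.
Proof.
have /eqP := ipDl 0 0 w.
by rewrite addr0 -{1}[ip 0 w]addr0 (inj_eq (addrI _)) eq_sym => /eqP.
Qed.
Lemma ipZl a u w : ip (a *: u) w = a * ip u w.
Proof. by rewrite -[a *: u]addr0 (ip_linear hip) ip0l addr0. Qed.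
Lemma ipNl u w : ip (- u) w = - ip u w.
Proof. by rewrite -scaleN1r ipZl mulN1r. Qed.
Lemma ipBl u v w : ip (u - v) w = ip u w - ip v w.
Proof. by rewrite ipDl ipNl. Qed.
Lemma ipDr u v w : ip w (u + v) = ip w u + ip w v.
Proof. by rewrite ![ip w _](ip_conj hip) ipDl rmorphD. Qed.
Lemma ip0r w : ip w 0 = 0.
Proof. by rewrite (ip_conj hip) ip0l rmorph0. Qed.
Lemma ipZr a u w : ip w (a *: u) = Num.conj a * ip w u.
Proof. by rewrite ![ip w _](ip_conj hip) ipZl rmorphM. Qed.
Lemma ipNr u w : ip w (- u) = - ip w u.
Proof. by rewrite ![ip w _](ip_conj hip) ipNl rmorphN. Qed.
Lemma ipBr u v w : ip w (u - v) = ip w u - ip w v.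
Proof. by rewrite ipDr ipNr. Qed.
Lemma ip_suml I (r : seq I) (F : I -> H) w :
  ip (\sum_(i <- r) F i) w = \sum_(i <- r) ip (F i) w.
Proof. exact: (big_morph (fun u => ip u w) (fun u v => ipDl u v w) (ip0l w)). Qed.
Lemma ip_sumr I (r : seq I) (F : I -> H) w :
  ip w (\sum_(i <- r) F i) = \sum_(i <- r) ip w (F i).
Proof. exact: (big_morph (ip w) (fun u v => ipDr u v w) (ip0r w)). Qed.

Lemma Im_ip u : Im (ip u u) = 0.
Proof.
have := ip_conj hip u u; case: (ip u u) => a b [] /= /eqP.
by rewrite -addr_eq0 -mulr2n mulrn_eq0/= => /eqP.
Qed.

Lemma ip_self u : ip u u = (Re (ip u u))%:C.
Proof. by apply: complex_eq => //=; rewrite Im_ip. Qed.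

Lemma sqr_hnorm u : hnorm u ^+ 2 = Re (ip u u).
Proof. by rewrite /hnorm sqr_sqrtr// ip_ge0. Qed.

Lemma hnorm_ge0 u : 0 <= hnorm u.
Proof. exact: sqrtr_ge0. Qed.

Lemma hnorm0_eq0 u : hnorm u = 0 -> u = 0.
Proof. by move=> u0; apply: (ip_eq0 hip); rewrite -sqr_hnorm u0 expr0n. Qed.

Lemma cauchy_schwarz u v : normc (ip u v) <= hnorm u * hnorm v.
Proof.
rewrite -(@ler_pXn2r _ 2)// ?nnegrE ?normc_ge0 ?mulr_ge0 ?hnorm_ge0//.
rewrite exprMn !sqr_hnorm.
have [v0|v0] := eqVneq (Re (ip v v)) 0.
  by rewrite (ip_eq0 hip v0) ip0r normc0 expr0n/= ip0r mulr0.
have vgt0 : 0 < Re (ip v v) by rewrite lt_neqAle eq_sym v0 (ip_ge0 hip).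
have := ip_ge0 hip ((Re (ip v v))%:C *: u - ip u v *: v).
rewrite ipBl !ipBr !ipZl !ipZr [ip v u](ip_conj hip) (ip_self u) (ip_self v).
rewrite normc_def2; move: (ip u v) (Re (ip u u)) => -[p q] a.
set b := Re (ip v v) in vgt0 *.
rewrite !ReIm/= => h.
have {}h : 0 <= b * (a * b - (p ^+ 2 + q ^+ 2)) by apply: le_trans h _; lra.
by rewrite -subr_ge0 -(pmulr_rge0 _ vgt0).
Qed.

Lemma hnormZ a u : hnorm (a *: u) = normc a * hnorm u.
Proof.
apply/eqP; rewrite -(@eqrXn2 _ 2)// ?mulr_ge0 ?normc_ge0 ?hnorm_ge0//.
rewrite exprMn !sqr_hnorm ipZl ipZr ip_self normc_def2 !ReIm/=.
by apply/eqP; ring.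
Qed.

Lemma hnormD u v : hnorm (u + v) <= hnorm u + hnorm v.
Proof.
rewrite -(@ler_pXn2r _ 2)// ?nnegrE ?addr_ge0 ?hnorm_ge0//.
rewrite sqrrD !sqr_hnorm ipDl !ipDr [ip v u](ip_conj hip) !ReIm.
have := cauchy_schwarz u v; have := Re_le_normc (ip u v).
move=> /ler_normlP[_ h1] h2; rewrite mulr2n; lra.
Qed.

(** For [v] in [D] close to [u], [f u] equals [f (u - v)], which is small. The radius uses [|K| + 1]
    so that [K] may be any real number. *)
Lemma antilinear_dense (D : set H) (f : H -> R[i]) (K : R) :
  dense_set ip D -> (forall u v, f (u - v) = f u - f v) ->
  (forall u, normc (f u) <= K * hnorm u) -> (forall u, D u -> f u = 0) ->
  forall u, f u = 0.
Proof.
move=> dD fB fK f0 u; apply: eq0_normc; apply/eqP.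
rewrite eq_le normc_ge0 andbT; apply/ler_addgt0Pl => e e0; rewrite addr0.
have K0 : 0 < `|K| + 1 by rewrite ltr_wpDl.
have [v /f0 fv uv] := dD u (e / (`|K| + 1)) (divr_gt0 e0 K0).
rewrite -[f u]subr0 -fv -fB (le_trans (fK _))//.
rewrite ltr_pdivlMr// in uv; apply: le_trans (ltW uv).
rewrite mulrC ler_wpM2l ?hnorm_ge0//.
by rewrite (le_trans (ler_norm _))// lerDl.
Qed.

Lemma dense_orthogonal (D : set H) u :
  dense_set ip D -> (forall v, D v -> ip u v = 0) -> u = 0.
Proof.
move=> dD u0; suff /(_ u) uu : forall v, ip u v = 0.
  by apply: (ip_eq0 hip); rewrite uu.
apply: (antilinear_dense (K := hnorm u) dD) => // [v w|v].
  by rewrite ipBr.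
exact: cauchy_schwarz.
Qed.

(** Gram-Schmidt by induction on [m]: if [x'] and [f] are the residues of [x] and of the last vector
    against the earlier ones, the new residue is [x' - t f]. The vectors may be linearly dependent:
    when [f] is zero every [t] will do, in particular the quotient by zero. *)
Lemma orthogonal_decomposition m (e : 'I_m -> H) x :
  exists (c : 'I_m -> R[i]), forall k, ip (x - \sum_j c j *: e j) (e k) = 0.
Proof.
elim: m e x => [|m IHm] e x; first by exists (fun=> 0) => -[].
pose e' i := e (widen_ord (leqnSn m) i).
have [c hc] := IHm e' x; have [d hd] := IHm e' (e ord_max).
set x' := x - _ in hc; set f := e ord_max - _ in hd.
pose t := ip x' f / ip f f.
pose cc (j : 'I_m.+1) :=
  if unlift ord_max j is Some i then c i - t * d i else t.
exists cc.
have ccE : x - \sum_j cc j *: e j = x' - t *: f.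
  rewrite big_ord_recr/= /cc unlift_none /x' /f.
  have -> : \sum_(i < m) (match unlift ord_max (widen_ord (leqnSn m) i) with
     | Some i0 => c i0 - t * d i0 | None => t end) *: e (widen_ord (leqnSn m) i)
     = \sum_(i < m) c i *: e' i - t *: \sum_(i < m) d i *: e' i.
    rewrite scaler_sumr -sumrB; apply: eq_bigr => i _.
    have wl : widen_ord (leqnSn m) i = lift ord_max i.
      by apply/val_inj => /=; rewrite /bump leqNgt ltn_ord.
    by rewrite {1}wl liftK scalerBl scalerA.
  rewrite scalerBr; set a1 := \sum_(i < m) c i *: _; set a2 := t *: _.
  by rewrite -[RHS]addrA -opprD [_ *: e _ - a2]addrC addrA.
rewrite ccE.
have e'0 i : ip (x' - t *: f) (e' i) = 0 by rewrite ipBl ipZl hc hd mulr0 subr0.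
have f0 : ip (x' - t *: f) f = 0.
  rewrite ipBl ipZl /t; have [ff0|ff0] := eqVneq (ip f f) 0.
    by rewrite (ip_eq0 hip (u := f)) ?ff0// !ip0r mulr0 subrr.
  by rewrite divfK// subrr.
move=> k; have [->|kmax] := eqVneq k ord_max.
  rewrite -[e ord_max](subrK (\sum_j d j *: e' j)) -/f ipDr f0 add0r.
  by rewrite ip_sumr big1// => i _; rewrite ipZr e'0 mulr0.
have kh : (k < m)%N.
  by rewrite ltn_neqAle -ltnS ltn_ord andbT; apply: contra_neq kmax => kE; apply/val_inj.
suff -> : e k = e' (Ordinal kh) by [].
by congr e; apply/val_inj.
Qed.

End PreHilbert.

(** * Projection-valued measures of self-adjoint operators *)

Section SpectralMeasure.
Import HBNNSimple.
Context (R : realType) (H : lmodType R[i]) (ip : H -> H -> R[i]).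
Hypothesis hip : inner_product ip.
Variable P : set R -> H -> H.
Hypothesis hP : projection_valued_measure ip P.
Implicit Types (u v w x y : H) (S : set R).

Lemma pvm_linear S a u v : measurable S -> P S (a *: u + v) = a *: P S u + P S v.
Proof. by move=> /(pvm_proj hP)[]. Qed.

Lemma pvmD S u v : measurable S -> P S (u + v) = P S u + P S v.
Proof. by move=> mS; rewrite -[u in LHS]scale1r pvm_linear// scale1r. Qed.

Lemma pvm0 S : measurable S -> P S 0 = 0.
Proof.
move=> mS; have /eqP := pvmD 0 0 mS.
by rewrite addr0 -{1}[P S 0]addr0 (inj_eq (addrI _)) eq_sym => /eqP.
Qed.

Lemma pvmZ S a u : measurable S -> P S (a *: u) = a *: P S u.
Proof. by move=> mS; rewrite -[a *: u]addr0 pvm_linear// pvm0// addr0. Qed.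

Lemma pvmB S u v : measurable S -> P S (u - v) = P S u - P S v.
Proof. by move=> mS; rewrite pvmD// -scaleN1r pvmZ// scaleN1r. Qed.

Lemma pvm_sym S u v : measurable S -> ip (P S u) v = ip u (P S v).
Proof. by move=> /(pvm_proj hP)[]. Qed.

Lemma pvm_idem S u : measurable S -> P S (P S u) = P S u.
Proof. by move=> /(pvm_proj hP)[]. Qed.

Lemma pvm_disjoint S S' u : measurable S -> measurable S' ->
  S `&` S' = set0 -> P S (P S' u) = 0.
Proof. by move=> mS mS' SS'; rewrite -(pvm_setI hP)// SS' (pvm_set0 hP). Qed.

Lemma pvm_normE S u : measurable S -> ip (P S u) u = ip (P S u) (P S u).
Proof. by move=> mS; rewrite -{1}(pvm_idem u mS) pvm_sym. Qed.

(** The sequence [S, S', set0, set0, ...] has constant partial sums from rank 2 on, so the limit in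
    countable additivity is an equality. *)
Lemma pvmU S S' u : measurable S -> measurable S' -> S `&` S' = set0 ->
  P (S `|` S') u = P S u + P S' u.
Proof.
move=> mS mS' SS'.
have m2 k : measurable (bigcup2 S S' k).
  by case: k => [//|[//|k]]; rewrite /bigcup2/=.
have t2 : trivIset setT (bigcup2 S S') by rewrite -trivIset_bigcup2.
have := pvm_bigcup hP u m2 t2; rewrite bigcup2E => h.
have c : hnorm ip (\sum_(k < N) P (bigcup2 S S' k) u - P (S `|` S') u)
    @[N --> \oo] --> hnorm ip (P S u + P S' u - P (S `|` S') u).
  apply: cvg_near_cst; near=> N.
  have -> : N = N.-2.+2 by rewrite -subn2 -addn2 subnK//; near: N; exact: nbhs_infty_ge.
  rewrite !big_ord_recl /= big1 ?addr0 // => i _.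
  by rewrite /bigcup2/= (pvm_set0 hP).
have /(hnorm0_eq0 hip)/eqP : hnorm ip (P S u + P S' u - P (S `|` S') u) = 0.
  exact: (cvg_unique _ c h).
by rewrite subr_eq0 => /eqP ->.
Unshelve. all: by end_near. Qed.

Lemma pvm_splitE S u : measurable S -> u = P S u + P (~` S) u.
Proof.
move=> mS; rewrite -pvmU ?setICr//; last exact: measurableC.
by rewrite setUCr (pvm_setT hP).
Qed.

(* [hip] and [hP] are kept as arguments for the canonical measure structure, and
   the value is [0] off the measurable sets, where [P] is arbitrary. *)
Definition pvm_meas & inner_product ip & projection_valued_measure ip P :=
  fun u S =>
  if `[< measurable S >] then (Re (ip (P S u) u))%:E else 0%E.
Local Notation mu := (pvm_meas hip hP).

Lemma pvm_measE u S : measurable S -> mu u S = (Re (ip (P S u) u))%:E.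
Proof. by rewrite /pvm_meas; case: asboolP. Qed.

Let mu0 u : mu u set0 = 0%E.
Proof. by rewrite pvm_measE// (pvm_set0 hP) ip0l. Qed.

Let mu_ge0 u S : (0 <= mu u S)%E.
Proof.
rewrite /pvm_meas; case: asboolP => // mS.
by rewrite lee_fin pvm_normE// (ip_ge0 hip).
Qed.

Let mu_sigma_additive u : semi_sigma_additive (mu u).
Proof.
move=> F mF tF mUF; rewrite pvm_measE//.
under eq_fun.
  move=> n; under eq_bigr do rewrite pvm_measE//.
  rewrite sumEFin -Re_sum -ip_suml//.
  over.
apply: cvg_EFin; first by near=> n.
rewrite /comp /=.
(* By Cauchy-Schwarz, norm convergence of the partial sums implies convergence of their scalar
   products with [u]. *)
have K : (fun n => hnorm ip (\sum_(0 <= k < n) P (F k) u - P (\bigcup_k F k) u)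
    * hnorm ip u) @ \oo --> (0 : R).
  rewrite -[X in _ --> X](mul0r (hnorm ip u)).
  apply: cvgMl; under eq_fun do rewrite big_mkord.
  exact: (pvm_bigcup hP).
apply/subr_cvg0; apply/norm_cvg0P.
apply: squeeze_cvgr K; last exact: cvg_cst.
near=> n; rewrite normr_ge0/= -ReN -ReD -ipNl// -ipDl//.
exact: le_trans (Re_le_normc _) (cauchy_schwarz _ _ _).
Unshelve. all: by end_near. Qed.

HB.instance Definition _ u :=
  isMeasure.Build _ R R (mu u) (mu0 u) (mu_ge0 u) (@mu_sigma_additive u).

Let mu_fin u : fin_num_fun (mu u).
Proof. by move=> S mS; rewrite pvm_measE. Qed.

HB.instance Definition _ u := Measure_isFinite.Build _ R R (mu u) (mu_fin u).

(** [scalar_measure] is arbitrary off the Borel sets, but the integral is a difference of suprema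
    over simple functions, which evaluate the set function only at measurable level sets. *)
Lemma pvm_integralE u (f : R -> \bar R) :
  (\int[scalar_measure ip P u]_t f t = \int[mu u]_t f t)%E.
Proof.
have sE (h : {nnsfun R >-> R}) :
    sintegral (scalar_measure ip P u) h = sintegral (mu u) h.
  apply: eq_fsbigr => x _; congr (_ * _)%E; rewrite pvm_measE//.
have nE (g : R -> \bar R) :
    ereal_sup [set sintegral (scalar_measure ip P u) h | h in
      [set h : {nnsfun R >-> R} | forall t, ((h t)%:E <= g t)%E]] =
    ereal_sup [set sintegral (mu u) h | h in
      [set h : {nnsfun R >-> R} | forall t, ((h t)%:E <= g t)%E]].
  by congr ereal_sup; apply: eq_imagel => h _; exact: sE.
by rewrite /integral; congr (_ - _)%E; exact: nE.
Qed.

End SpectralMeasure.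

(** * Spectral projections of a self-adjoint operator *)

Section SelfAdjointSpectral.
Context (R : realType) (H : lmodType R[i]) (ip : H -> H -> R[i]).
Hypothesis hip : inner_product ip.
Variable P : set R -> H -> H.
Variable A : set (H * H).
Hypothesis hA : self_adjoint ip A.
Hypothesis hAP : spectral_measure_of ip A P.
Implicit Types (u v w x y : H) (S : set R).

Let hP : projection_valued_measure ip P. Proof. by case: hAP. Qed.
Local Notation mu := (pvm_meas hip hP).

Lemma sa_sym u v x y : A (u, v) -> A (x, y) -> ip v x = ip u y.
Proof. by case: hA => _ _ AE uv; rewrite -{1}AE => /(_ _ _ uv). Qed.

Lemma sa_dense : dense_set ip (dom A). Proof. by case: hA. Qed.

Lemma sa_linear a u v u' v' :
  A (u, v) -> A (u', v') -> A (a *: u + u', a *: v + v').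
Proof. by case: hA => -[_ + _] _ _; apply. Qed.

Lemma sa_fun u v v' : A (u, v) -> A (u, v') -> v = v'.
Proof. by case: hA => -[_ _ +] _ _; apply. Qed.

Lemma sa_add u v u' v' : A (u, v) -> A (u', v') -> A (u + u', v + v').
Proof. by move=> h /(sa_linear 1 h); rewrite !scale1r. Qed.

Lemma sa_scale a u v : A (u, v) -> A (a *: u, a *: v).
Proof.
move=> h; have A0 : A (0, 0) by case: hA => -[].
by have := sa_linear a h A0; rewrite !addr0.
Qed.

Let domE u : dom A u <-> (\int[mu u]_t (t ^+ 2)%:E < +oo)%E.
Proof. by rewrite -pvm_integralE; case: hAP => _ -> _. Qed.

Let formE u v : A (u, v) -> ip v u = (fine (\int[mu u]_t t%:E))%:C.
Proof. by rewrite -pvm_integralE; case: hAP => _ _; apply. Qed.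

(** The cross terms [<P T u, w>] vanish, because [P T] commutes with [P S], which fixes [u] and
    kills [w]. *)
Let muD S u w : measurable S -> P S u = u -> P S w = 0 ->
  forall T, measurable T -> T `<=` setT ->
  mu (u + w) T = measure_add (mu u) (mu w) T.
Proof.
move=> mS Su Sw T mT _; rewrite measure_addE /= !pvm_measE// -EFinD; congr EFin.
rewrite (pvmD hP)// (ipDl hip) !(ipDr hip).
have uw : ip (P T u) w = 0.
  rewrite -{1}Su -(pvm_setI hP)// setIC (pvm_setI hP)// (pvm_sym hP)// Sw.
  by rewrite (ip0r hip).
have -> : ip (P T w) u = 0.
  by rewrite (pvm_sym hP)// (ip_conj hip) uw rmorph0.
by rewrite uw addr0 add0r ReD.
Qed.

(** The measure of [u] is the sum of those of its parts on [S] and on the complement, so its finite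
    second moment bounds the second moment of each part. *)
Lemma dom_pvm S u : measurable S -> dom A u -> dom A (P S u).
Proof.
move=> mS /domE; rewrite {1}(pvm_splitE hip hP u mS).
have mC : measurable (~` S) by exact: measurableC.
rewrite (eq_measure_integral _ (muD mS _ _)); last 2 first.
  exact: (pvm_idem hP).
  by rewrite (pvm_disjoint hP)// setICr.
rewrite ge0_integral_measure_add//; last first.
- by apply/measurable_EFinP; exact: measurable_funX.
- by move=> t _; rewrite lee_fin sqr_ge0.
move=> h; apply/domE; apply: le_lt_trans h; rewrite leeDl//.
by apply: integral_ge0 => t _; rewrite lee_fin sqr_ge0.
Qed.

Let int_id u : dom A u -> (mu u).-integrable setT (fun t => t%:E).
Proof.
move=> /domE du.
have i2 : (mu u).-integrable setT (fun t => (1 + t ^+ 2)%:E).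
  have -> : (fun t : R => (1 + t ^+ 2)%:E) = (EFin \o cst 1) \+ (fun t => (t ^+ 2)%:E) by [].
  apply: integrableD => //; first exact: finite_measure_integrable_cst.
  apply/integrableP; split; first by apply/measurable_EFinP; exact: measurable_funX.
  by under eq_integral do rewrite gee0_abs ?lee_fin ?sqr_ge0//.
apply: le_integrable i2 => //; first exact/measurable_EFinP.
move=> t _; rewrite !abse_EFin lee_fin [leRHS]ger0_norm ?addr_ge0 ?sqr_ge0//.
by rewrite -(real_normK (num_real t)); have := sqr_ge0 (`|t| - 1 / 2); nra.
Qed.

Let int_shift u l : dom A u ->
  (mu u).-integrable setT (EFin \o (fun t => t - l)) /\
  (\int[mu u]_t (t - l)%:E = \int[mu u]_t t%:E - (l * Re (ip u u))%:E)%E.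
Proof.
move=> du; have iu := int_id du.
have ic : (mu u).-integrable setT (fun t => l%:E).
  exact: finite_measure_integrable_cst.
split; first by have := integrableB measurableT iu ic; apply: eq_integrable.
under eq_integral do rewrite EFinB.
rewrite integralB_EFin//; congr (_ - _)%E.
by rewrite (integral_cst (mu u) measurableT l%:E) /= pvm_measE// (pvm_setT hP) EFinM.
Qed.

(** The measure of [u + w] is the sum of the two measures, so the quadratic form of [A] is additive
    at [u + w]; with symmetry this means [2 Re <v, w> = 0]. Replacing [w] by [i w] gives the
    imaginary part. *)
Lemma form_orthogonal S u v w w' : measurable S -> A (u, v) -> A (w, w') ->
  P S u = u -> P S w = 0 -> ip v w = 0.
Proof.
move=> mS; suff suf x x' : A (u, v) -> A (x, x') -> P S u = u -> P S x = 0 ->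
    Re (ip v x) = 0.
  move=> uv ww Su Sw; apply: complex_eq; first exact: (suf w w').
  have := suf ('i *: w) ('i *: w') uv (sa_scale _ ww) Su.
  rewrite (pvmZ hP)// Sw scaler0 => /(_ erefl).
  by rewrite (ipZr hip) !ReIm/= mul0r sub0r mulN1r opprK.
move=> uv xx Su Sx.
have := formE (sa_add uv xx).
rewrite (eq_measure_integral _ (muD mS Su Sx)) integral_measure_add//; last 2 first.
- by apply: int_id; exists v.
- by apply: int_id; exists x'.
rewrite fineD; last 2 first.
- by apply: integrable_fin_num => //; apply: int_id; exists v.
- by apply: integrable_fin_num => //; apply: int_id; exists x'.
rewrite rmorphD/= -(formE uv) -(formE xx) (ipDl hip) !(ipDr hip).
rewrite (sa_sym xx uv) [ip x v](ip_conj hip) => /(congr1 (@Re R)).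
rewrite !ReIm => h; lra.
Qed.

(** Let [x] and [y] be the images under [A] of the parts of [u] on [S] and on its complement. By
    [form_orthogonal] and density, [P] of the complement kills [x], and [P S] kills [y]. Hence
    [x = P S (x + y) = P S v]. *)
Lemma pvm_reduces S u v : measurable S -> A (u, v) -> A (P S u, P S v).
Proof.
move=> mS uv; have mC : measurable (~` S) by exact: measurableC.
have [x Sx] : dom A (P S u) by apply: dom_pvm => //; exists v.
have [y Cy] : dom A (P (~` S) u) by apply: dom_pvm => //; exists v.
have vE : v = x + y.
  apply: sa_fun uv _; rewrite {1}(pvm_splitE hip hP u mS); exact: sa_add.
have x0 : P (~` S) x = 0.
  apply: (dense_orthogonal hip sa_dense) => w dw.
  have [z zw] := dom_pvm mC dw.
  rewrite (pvm_sym hP)//; apply: (form_orthogonal mS Sx zw).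
    exact: (pvm_idem hP).
  by rewrite (pvm_disjoint hP)// setICr.
have y0 : P S y = 0.
  apply: (dense_orthogonal hip sa_dense) => w dw.
  have [z zw] := dom_pvm mS dw.
  rewrite (pvm_sym hP)//; apply: (form_orthogonal mC Cy zw).
    exact: (pvm_idem hP).
  by rewrite (pvm_disjoint hP)// setICl.
suff <- : x = P S v by [].
by rewrite vE (pvmD hP)// y0 addr0 {1}(pvm_splitE hip hP x mS) x0 addr0.
Qed.

(** * Vectors concentrated on a set within distance [e] of [l] *)

Section Concentrated.
Variables (S : set R) (l e : R).
Hypothesis mS : measurable S.
Hypothesis Sle : forall t, S t -> `|t - l| <= e.

Let muC0 u : P S u = u -> mu u (~` S) = 0%E.
Proof.
move=> Su; have mC : measurable (~` S) by exact: measurableC.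
by rewrite pvm_measE// -{1}Su (pvm_disjoint hP)// ?setICl// (ip0l hip).
Qed.

Let muS u : P S u = u -> mu u S = (Re (ip u u))%:E.
Proof. by move=> Su; rewrite pvm_measE// Su. Qed.

Lemma concentrated_dom u : P S u = u -> dom A u.
Proof.
move=> Su; have mC : measurable (~` S) by exact: measurableC.
have mt2 D : measurable_fun D (EFin \o (fun t : R => t ^+ 2)).
  by apply/measurable_EFinP; exact: measurable_funX.
apply/domE; rewrite (@ge0_negligible_integral _ _ _ _ _ (~` S))//; last 2 first.
- by move=> t _; rewrite lee_fin sqr_ge0.
- exact: muC0.
rewrite setTD setCK.
apply: (@le_lt_trans _ _ (\int[mu u]_(t in S) (cst ((`|l| + e) ^+ 2)%:E) t)%E).
  apply: ge0_le_integral => //.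
  - by move=> t _; rewrite lee_fin sqr_ge0.
  - move=> t St; rewrite lee_fin -(real_normK (num_real t)).
    have := Sle St; have := ler_normD (t - l) l; rewrite subrK => h1 h2.
    by rewrite ler_pXn2r// ?nnegrE ?addr_ge0// ?(le_trans _ h2)//; lra.
by rewrite integral_cst//= muS// -EFinM ltry.
Qed.

Lemma concentrated_form u v : P S u = u -> A (u, v) ->
  `|Re (ip (v - l%:C *: u) u)| <= e * Re (ip u u).
Proof.
move=> Su uv; have mC : measurable (~` S) by exact: measurableC.
have du : dom A u by exists v.
have [il iE] := int_shift l du.
have fi : (\int[mu u]_t t%:E)%E \is a fin_num.
  by apply: integrable_fin_num => //; exact: int_id.
have -> : Re (ip (v - l%:C *: u) u) = fine (\int[mu u]_t (t - l)%:E).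
  rewrite iE -(fineK fi) -EFinB (ipBl hip) (ipZl hip) (formE uv) !ReIm/=.
  by rewrite mul0r subr0.
rewrite -lee_fin -fine_abse; last exact: integrable_fin_num il.
have ml D : measurable_fun D (EFin \o (fun t : R => t - l)).
  by apply/measurable_EFinP; exact: measurable_funB.
have mal D : measurable_fun D (abse \o (EFin \o (fun t : R => t - l))).
  exact: measurableT_comp.
rewrite fineK; last by rewrite abse_fin_num; exact: integrable_fin_num il.
apply: le_trans (le_abse_integral _ _ _) _ => //.
rewrite (@ge0_negligible_integral _ _ _ _ _ (~` S))//; last exact: muC0.
rewrite setTD setCK EFinM -muS// -integral_cst//.
by apply: ge0_le_integral => //= t St; rewrite lee_fin; exact: Sle.
Qed.

(* With [z := (A - l) u], polarization of the form of [A - l] at [u + z] and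
   [u - z] bounds [<(A - l) u, z> = |z|^2]. *)
Lemma concentrated_bound u : e <= 1 -> P S u = u ->
  exists2 v, A (u, v) &
    Re (ip (v - l%:C *: u) (v - l%:C *: u)) <= e * Re (ip u u).
Proof.
move=> e1 Su; have [v uv] := concentrated_dom Su; exists v => //.
set z := v - _.
have Sv : P S v = v by apply: (sa_fun _ uv); rewrite -{1}Su; exact: pvm_reduces.
have Sz : P S z = z by rewrite /z (pvmB hP)// (pvmZ hP)// Sv Su.
have [z' zz] := concentrated_dom Sz.
have h1 := concentrated_form (u := u + z) (v := v + z') _ (sa_add uv zz).
have uz : A (u - z, v - z').
  by have := sa_linear (-1) zz uv; rewrite !scaleN1r ![- _ + _]addrC.
have h2 := concentrated_form (u := u - z) (v := v - z') _ uz.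
move: h1 h2; rewrite (pvmD hP)// (pvmB hP)// Su Sz => /(_ erefl) h1 /(_ erefl) h2.
pose z2 := z' - l%:C *: z.
have zE : v + z' - l%:C *: (u + z) = z + z2.
  by rewrite scalerDr opprD addrACA.
have zE' : v - z' - l%:C *: (u - z) = z - z2.
  have -> : z - z2 = (v - l%:C *: u) - z2 by [].
  by rewrite /z2 scalerBr !opprD !opprK addrACA.
have z2u : ip z2 u = ip z z.
  rewrite /z2 (ipBl hip) (ipZl hip) (sa_sym zz uv).
  have -> : ip z z = ip z (v - l%:C *: u) by [].
  by rewrite (ipBr hip) (ipZr hip) conjE/= oppr0 complexr0.
clearbody z2; clearbody z.
move: h1 h2; rewrite zE zE' !(ipDl hip, ipBl hip, ipDr hip, ipBr hip, ipNl hip, ipNr hip) z2u.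
rewrite [ip z u](ip_conj hip) !ReIm => /ler_normlP[h1 h1'] /ler_normlP[h2 h2'].
have := ip_ge0 hip z; have := ip_ge0 hip u => hu hz.
(* The difference of the two forms is [4 |z|^2], and the bounds add up to [2 e (|u|^2 + |z|^2)] by
   the parallelogram law; [e <= 1] absorbs the term in [z]. *)
have := ler_wpM2r hz e1; nra.
Qed.

End Concentrated.

(** The singleton lies within distance [0] of [l], so [concentrated_bound] gives
    [|(A - l) u|^2 <= 0]. *)
Lemma pvm_set1_eigen l u : P [set l] u = u -> A (u, l%:C *: u).
Proof.
have Sle : forall t : R, [set l] t -> `|t - l| <= 0.
  by move=> t ->; rewrite subrr normr0.
move=> lu; have [v uv] := concentrated_bound (measurable_set1 l) Sle ler01 lu.
rewrite mul0r => h; suff <- : v = l%:C *: u by [].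
apply/eqP; rewrite -subr_eq0; apply/eqP/(ip_eq0 hip)/eqP.
by rewrite eq_le h (ip_ge0 hip).
Qed.

(** Paired with [u], the eigenvalue equation only says that [t - l] has integral zero against the
    measure of [u]. With [S] on one side of [l] the integrand has constant sign and no zero on [S],
    so the measure must vanish there. *)
Lemma eigen_pvm_eq0 l S u : measurable S -> P S u = u -> A (u, l%:C *: u) ->
  (forall t, S t -> t != l) -> (forall t, S t -> l <= t) \/ (forall t, S t -> t <= l) ->
  u = 0.
Proof.
move=> mS Su lu Sl side; have mC : measurable (~` S) by exact: measurableC.
have du : dom A u by exists (l%:C *: u).
have [il iE] := int_shift l du.
have ml D : measurable_fun D (EFin \o (fun t : R => t - l)).
  by apply/measurable_EFinP; exact: measurable_funB.
have muS0 : mu u (~` S) = 0%E.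
  by rewrite pvm_measE// -{1}Su (pvm_disjoint hP)// ?setICl// (ip0l hip).
have i0 : (\int[mu u]_(t in S) (t - l)%:E = 0)%E.
  rewrite -[S]setCK -setTD -(negligible_integral (D := setT))// iE.
  have fi : (\int[mu u]_t t%:E)%E \is a fin_num.
    by apply: integrable_fin_num => //; exact: int_id.
  have := formE lu; rewrite (ipZl hip) => /(congr1 (@Re R)).
  rewrite ReM/= mul0r subr0 => lE.
  by rewrite lE -(fineK fi) -EFinB/= subrr.
have {}i0 : (\int[mu u]_(t in S) `|(t - l)%:E| = 0)%E.
  case: side => side.
    rewrite -[RHS]i0; apply: eq_integral => t /set_mem/side tl.
    by rewrite gee0_abs// lee_fin subr_ge0.
  under eq_integral.
    move=> t /set_mem/side tl; rewrite lee0_abs ?lee_fin ?subr_le0//.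
    over.
  rewrite integralN/= ?i0 ?oppe0//.
  exact: integrable_add_def (integrableS measurableT mS (@subsetT _ _) il).
move/(ae_eq_integral_abs (mu u) mS (ml S)) : i0 => ae0.
have muS : mu u S = 0%E.
  case: ae0 => N [mN N0 SN]; apply/eqP.
  rewrite eq_le measure_ge0 andbT -N0; apply: le_measure; rewrite ?inE//.
  move=> t St; apply: SN => /(_ St)/=.
  by case=> /eqP; rewrite subr_eq0; apply/negP/Sl.
apply: (ip_eq0 hip).
by move: muS; rewrite pvm_measE// Su => -[].
Qed.

(** By [pvm_reduces] the parts of [u] on the two open half-lines at [l] satisfy the same eigenvalue
    equation, so each of them is zero. *)
Lemma eigen_pvm_set1 l u : A (u, l%:C *: u) -> P [set l] u = u.
Proof.
move=> lu.
have red S : measurable S -> A (P S u, l%:C *: P S u).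
  by move=> mS; rewrite -(pvmZ hP)//; exact: pvm_reduces.
have up : P `]l, +oo[ u = 0.
  apply: (@eigen_pvm_eq0 l `]l, +oo[) => //; first exact: (pvm_idem hP).
  - exact: red.
  - by move=> t /=; rewrite in_itv/= andbT => /gt_eqF ->.
  - by left => t /=; rewrite in_itv/= andbT => /ltW.
have dn : P `]-oo, l[ u = 0.
  apply: (@eigen_pvm_eq0 l `]-oo, l[) => //; first exact: (pvm_idem hP).
  - exact: red.
  - by move=> t /=; rewrite in_itv/= => /lt_eqF ->.
  - by right => t /=; rewrite in_itv/= => /ltW.
have mC : measurable (~` [set l] : set R) by exact: measurableC.
rewrite [RHS](pvm_splitE hip hP u (measurable_set1 l)).
rewrite (_ : ~` [set l] = `]-oo, l[ `|` `]l, +oo[) ?(pvmU hip hP)// ?up ?dn ?addr0//.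
  apply/seteqP; split=> t //=; rewrite !in_itv/= andbT => -[+ +].
  by move=> /lt_trans h /h; rewrite ltxx.
apply/seteqP; split=> t /=; rewrite !in_itv/= andbT.
  by move=> /eqP; rewrite neq_lt => /orP.
by case=> [/lt_eqF|/gt_eqF] /eqP.
Qed.

(** For [w] in the range of [P S], [|w|^2 <= M^2 |(A - l) w|^2 <= M^2 e |w|^2]. The choice of [e]
    ensures both [M^2 e < 1] and the condition [e <= 1] of [concentrated_bound]. *)
Lemma resolvent_pvm_gap l M :
  (forall u v, A (u, v) -> hnorm ip u <= M * hnorm ip (v - l%:C *: u)) ->
  exists2 e, 0 < e & forall S, measurable S ->
    (forall t, S t -> `|t - l| <= e) -> forall u, P S u = 0.
Proof.
move=> hM; pose e := (M ^+ 2 + 1)^-1 / 2.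
have M1 : 0 < M ^+ 2 + 1 by rewrite ltr_wpDl ?sqr_ge0.
have e0 : 0 < e by rewrite divr_gt0 ?invr_gt0.
have Me : M ^+ 2 * e < 1.
  rewrite /e mulrA ltr_pdivrMr// mul1r ltr_pdivrMr//.
  have := sqr_ge0 M; lra.
have e1 : e <= 1.
  rewrite /e ler_pdivrMr// mul1r invf_ple ?posrE//.
  have := sqr_ge0 M; lra.
exists e => // S mS Sle u; set w := P S u.
have Sw : P S w = w by exact: (pvm_idem hP).
have [v wv h] := concentrated_bound mS Sle e1 Sw.
have := hM _ _ wv; rewrite -sqr_hnorm// in h; set a := hnorm ip w in h *.
have a0 : 0 <= a by exact: hnorm_ge0.
set b := hnorm _ _ in h * => hab; have b0 : 0 <= b by exact: hnorm_ge0.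
rewrite -sqr_hnorm// in h; rewrite -/a in h.
have : a ^+ 2 <= M ^+ 2 * e * a ^+ 2.
  have h1 : a ^+ 2 <= (M * b) ^+ 2.
    by rewrite ler_pXn2r ?nnegrE// (le_trans a0).
  apply: le_trans h1 _; rewrite exprMn -mulrA ler_wpM2l ?sqr_ge0//.
move=> h2; apply: (hnorm0_eq0 hip); rewrite -/a; apply/eqP.
rewrite -sqrf_eq0 eq_le sqr_ge0 andbT.
have := sqr_ge0 a; nra.
Qed.

End SelfAdjointSpectral.

(** * Null sets of the spectral measure, atoms and spectrum *)

Section SpectralSupport.
Context (R : realType) (H : lmodType R[i]) (ip : H -> H -> R[i]).
Hypothesis hip : inner_product ip.
Variable P : set R -> H -> H.
Hypothesis hP : projection_valued_measure ip P.
Implicit Types (u : H) (S : set R).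

Lemma pvm_sub_eq0 S S' u : measurable S -> measurable S' -> S `<=` S' ->
  P S' u = 0 -> P S u = 0.
Proof.
move=> mS mS' SS' u0; rewrite -(setIidl SS') (pvm_setI hP)// u0.
exact: (pvm0 hP).
Qed.

Lemma pvm_bigcup_eq0 (F : (set R)^nat) u : (forall k, measurable (F k)) ->
  (forall k, P (F k) u = 0) -> P (\bigcup_k F k) u = 0.
Proof.
move=> mF F0; rewrite seqDU_bigcup_eq.
have mD k : measurable (seqDU F k).
  by apply: measurableD => //; apply: bigsetU_measurable.
have := pvm_bigcup hP u mD (trivIset_seqDU F).
under eq_fun.
  move=> N; rewrite big1; last first.
    move=> k _; apply: (pvm_sub_eq0 _ (mF k)) => //; exact: subset_seqDU.
  over.
rewrite sub0r => h.
have /(hnorm0_eq0 hip)/eqP : hnorm ip (- P (\bigcup_k seqDU F k) u) = 0.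
  by apply: (cvg_unique _ _ h) => //; exact: cvg_cst.
by rewrite oppr_eq0 => /eqP.
Qed.

Lemma pvm_countable_eq0 S u : countable S ->
  (forall t, S t -> P [set t] u = 0) -> P S u = 0.
Proof.
move=> /countable_injP[g gI] S0.
have -> : S = \bigcup_k (S `&` g @^-1` [set k]).
  by apply/seteqP; split=> [t St|t [k _ []//]]; exists (g t).
have SE k : S `&` g @^-1` [set k] = set0 \/
    exists2 t, S t & S `&` g @^-1` [set k] = [set t].
  have [[t [St gt]]|] := pselect (exists t, (S `&` g @^-1` [set k]) t).
    right; exists t => //; apply/seteqP; split=> [s [Ss gs]|s ->//].
    by apply: gI; rewrite ?inE//= gs gt.
  by move/forallNP => h; left; apply/seteqP; split=> // t /h.
apply: pvm_bigcup_eq0 => k; have [->|[t St ->]] := SE k => //.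
- exact: (pvm_set0 hP).
- exact: S0.
Qed.

End SpectralSupport.

Section SpectralAtoms.
Context (R : realType) (H : lmodType R[i]) (ip : H -> H -> R[i]).
Hypothesis hip : inner_product ip.
Variable P : set R -> H -> H.
Variable A : set (H * H).
Hypothesis hA : self_adjoint ip A.
Hypothesis hAP : spectral_measure_of ip A P.

Let hP : projection_valued_measure ip P. Proof. by case: hAP. Qed.
Local Notation real_spectrum := [set t : R | spectrum ip A t%:C].

Lemma eigen_spectrum l u : A (u, l *: u) -> u <> 0 -> spectrum ip A l.
Proof.
move=> lu u0 [_ [M hM]]; apply: u0; apply: (hnorm0_eq0 hip); apply/eqP.
rewrite eq_le (hnorm_ge0 ip) andbT (le_trans (hM _ _ lu))// subrr.
by rewrite /hnorm (ip0l hip) sqrtr0 mulr0.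
Qed.

Lemma range_pvm_set1 t : range (P [set t]) = [set u | A (u, t%:C *: u)].
Proof.
apply/seteqP; split=> [_ [u _ <-]|u /= tu].
  apply: (pvm_set1_eigen hip hA hAP); exact: (pvm_idem hP).
by exists u => //; exact: (eigen_pvm_set1 hip hA hAP).
Qed.

Lemma atom_spectrum t u : P [set t] u <> 0 -> real_spectrum t.
Proof.
move=> tu; apply: eigen_spectrum tu.
by have /seteqP[+ _] := range_pvm_set1 t; apply; exists u.
Qed.

(** Every point of [S] has a neighbourhood on which [P] vanishes, but null sets may only be united
    countably. Each neighbourhood is shrunk to an interval with rational endpoints, and [F]
    enumerates those rational intervals on which [P] vanishes. *)
Lemma pvm_resolvent_set S u : measurable S ->
  (forall t, S t -> ~ real_spectrum t) -> P S u = 0.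
Proof.
move=> mS SR.
pose G (q : rat * rat) : set R := `]ratr q.1, ratr q.2[%classic.
pose F n : set R := if unpickle n is Some q then
  if `[< forall v, P (G q) v = 0 >] then G q else set0 else set0.
have mF n : measurable (F n).
  by rewrite /F; case: unpickle => // q; case: ifP => // _; exact: measurable_itv.
have F0 n : P (F n) u = 0.
  rewrite /F; case: unpickle => [q|]; last exact: (pvm_set0 hP).
  by case: asboolP => [->//|_]; exact: (pvm_set0 hP).
apply: (pvm_sub_eq0 hP mS _ _ (pvm_bigcup_eq0 hip hP mF F0)).
  exact: bigcup_measurable.
move=> t /SR/contrapT[_ [M /(resolvent_pvm_gap hip hA hAP)[e e0 gap]]].
have te : t - e < t by rewrite gtrBl.
have [q1 /andP[eq1 q1t]] := rat_in_itvoo te.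
have et : t < t + e by rewrite ltrDl.
have [q2 /andP[tq2 q2e]] := rat_in_itvoo et.
rewrite !bnd_simp in eq1 q1t tq2 q2e.
suff Ft : F (pickle (q1, q2)) t by exact: (ex_intro2 _ _ (pickle (q1, q2)) I Ft).
rewrite /F pickleK.
case: asboolP => [_|]; first by rewrite /G/= in_itv/= q1t.
case; apply: gap; first exact: measurable_itv.
move=> s; rewrite /G/= in_itv/= => /andP[q1s sq2].
by rewrite ler_norml; apply/andP; split; lra.
Qed.

Lemma pvm_supported : countable real_spectrum -> supported_on P (spectrum ip A).
Proof.
move=> cS; have mS : measurable real_spectrum by exact: countable_measurable.
split=> // u; apply: pvm_resolvent_set => //; exact: measurableC.
Qed.

(** Off the atoms lie the real resolvent points, null by [pvm_resolvent_set], and the points of the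
    spectrum that are not atoms: countably many null points. *)
Lemma pvm_atomic : countable real_spectrum -> atomic P.
Proof.
move=> cS; set atoms := [set t : R | exists u, P [set t] u <> 0].
have aS : atoms `<=` real_spectrum by move=> t [u]; exact: atom_spectrum.
have ca : countable atoms by exact: sub_countable (subset_card_le aS) cS.
split=> // u.
have mS : measurable real_spectrum by exact: countable_measurable.
have ma : measurable atoms by exact: countable_measurable.
have cD : countable (real_spectrum `\` atoms).
  by apply: sub_countable cS; apply: subset_card_le => t [].
have mD : measurable (real_spectrum `\` atoms) by exact: measurableD.
have -> : ~` atoms = ~` real_spectrum `|` (real_spectrum `\` atoms).
  apply/seteqP; split=> t /=.
    by move=> ta; have [ts|ts] := pselect (real_spectrum t); [right|left].
  by case=> [ts /aS|[]].
rewrite (pvmU hip hP)//; last 2 first.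
- exact: measurableC.
- by apply/seteqP; split=> // t [ts []].
rewrite pvm_resolvent_set//; last exact: measurableC.
rewrite add0r; apply: (pvm_countable_eq0 hip hP) => // t [_ /forallNP/(_ u)].
by move/contrapT.
Qed.

End SpectralAtoms.

(** * The complex exponential *)

Section ComplexExponential.
Context (R : realType).
Implicit Types z w : R[i].

Lemma Re_cexp z : Re (cexp z) = expR (Re z) * cos (Im z).
Proof. by rewrite /cexp ReM/= mul0r subr0. Qed.

Lemma Im_cexp z : Im (cexp z) = expR (Re z) * sin (Im z).
Proof. by rewrite /cexp ImM/= mul0r addr0. Qed.

Lemma cexpD z w : cexp (z + w) = cexp z * cexp w.
Proof.
apply: complex_eq; rewrite !(ReM, ImM, Re_cexp, Im_cexp) ReD ImD expRD.
  by rewrite cosD/=; ring.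
by rewrite sinD/=; ring.
Qed.

Lemma cexp0 : cexp (0 : R[i]) = 1.
Proof. by apply: complex_eq; rewrite ?Re_cexp ?Im_cexp/= expR0 ?cos0 ?sin0 ?mulr0 ?mulr1. Qed.

Lemma cexpNK z : cexp (- z) * cexp z = 1.
Proof. by rewrite -cexpD addNr cexp0. Qed.

Lemma cexpKN z : cexp z * cexp (- z) = 1.
Proof. by rewrite mulrC cexpNK. Qed.

Lemma conj_cexp z : Num.conj (cexp z) = cexp (Num.conj z).
Proof.
apply: complex_eq; rewrite !(ReJ, ImJ, Re_cexp, Im_cexp) ?cosN//.
by rewrite sinN mulrN.
Qed.

Lemma normc_cexp z : normc (cexp z) = expR (Re z).
Proof.
apply/eqP; rewrite -(@eqrXn2 _ 2)// ?normc_ge0 ?expR_ge0// normc_def2.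
by rewrite Re_cexp Im_cexp !exprMn -mulrDr cos2Dsin2 mulr1.
Qed.

Lemma conjM z w : Num.conj (z * w) = Num.conj z * Num.conj w.
Proof. exact: rmorphM. Qed.

Lemma conj_twopii : Num.conj (twopii : R[i]) = - twopii.
Proof. by apply: complex_eq; rewrite !ReIm/=; ring. Qed.

Lemma twopii_neq0 : twopii != 0 :> R[i].
Proof.
apply/eqP => /(congr1 (@Im R)); rewrite ImM/= => /eqP.
by rewrite mul0r addr0 mulr1 mulf_eq0 pnatr_eq0/= gt_eqF ?pi_gt0.
Qed.

Lemma conj_twopiiV : Num.conj (twopii^-1 : R[i]) = - twopii^-1.
Proof.
have h : Num.conj (twopii^-1 : R[i]) * - twopii = 1.
  by rewrite -conj_twopii -conjM mulVf ?twopii_neq0// rmorph1.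
rewrite -[LHS]mulr1 -(mulfV twopii_neq0) mulrA -[X in X * _]opprK -mulrN h.
by rewrite mulN1r.
Qed.

Lemma conj_phase z (x : R) :
  Num.conj (cexp (twopii * z * x%:C)) = cexp (- twopii * Num.conj z * x%:C).
Proof. by rewrite conj_cexp; congr cexp; apply: complex_eq; rewrite !ReIm/=; ring. Qed.

Lemma conj_real (x : R) : Num.conj x%:C = x%:C.
Proof. by rewrite conjE/= oppr0. Qed.

End ComplexExponential.

(** * Elementary bounds for sine and cosine *)

Section TrigEstimates.
Context (R : realType).
Implicit Types x y : R.

Lemma continuous_within_derive (f df : R -> R) (D : set R) :
  (forall x, is_derive x 1 f (df x)) -> {within D, continuous f}.
Proof.
move=> fd; apply: continuous_subspaceT => x; apply: differentiable_continuous.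
by apply/derivable1_diffP; have [] := fd x.
Qed.

Lemma sinB_le x y : x <= y -> `|sin y - sin x| <= y - x.
Proof.
move=> xy; have [z _ ->] := MVT_segment xy (fun z _ => is_derive_sin z)
  (continuous_within_derive (@is_derive_sin R)).
by rewrite normrM (ger0_norm (_ : 0 <= y - x)) ?subr_ge0// ler_piMl ?subr_ge0// cos_max.
Qed.

Lemma cosB_le x y : x <= y -> `|cos y - cos x| <= y - x.
Proof.
move=> xy; have [z _ ->] := MVT_segment xy (fun z _ => is_derive_cos z)
  (continuous_within_derive (@is_derive_cos R)).
rewrite normrM (ger0_norm (_ : 0 <= y - x)) ?subr_ge0// ler_piMl ?subr_ge0//.
by rewrite normrN sin_max.
Qed.

(** By the half-angle formula, [cos x = 1 - 2 sin^2 (x / 2) >= 1 - x^2 / 2]. This bounds the slope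
    of the sine from below in [sinB_ge]. *)
Lemma cos_ge_half x : `|x| <= 1 -> 1 / 2 <= cos x.
Proof.
have sin_abs (y : R) : 0 <= y -> `|sin y| <= y.
  by move=> y0; have := sinB_le y0; rewrite sin0 !subr0.
wlog x0 : x / 0 <= x.
  move=> wl; have [/wl//|x0] := leP 0 x.
  by rewrite -normrN -cosN; apply: wl; rewrite oppr_ge0 ltW.
rewrite ger0_norm// => x1.
have x2 : 0 <= x / 2 by rewrite divr_ge0.
have h := sin_abs _ x2; have := sqr_ge0 (sin (x / 2)).
have -> : cos x = 1 - 2 * sin (x / 2) ^+ 2.
  rewrite [in LHS](splitr x) cosD -!expr2.
  by have := cos2Dsin2 (x / 2); lra.
have : sin (x / 2) ^+ 2 <= (x / 2) ^+ 2.
  by rewrite -(real_normK (num_real (sin _))) ler_pXn2r ?nnegrE.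
nra.
Qed.

Lemma sinB_ge x y : x <= y -> `|x| <= 1 -> `|y| <= 1 ->
  (y - x) / 2 <= sin y - sin x.
Proof.
move=> xy /ler_normlP[x1 x2] /ler_normlP[y1 y2].
have [z + ->] := MVT_segment xy (fun z _ => is_derive_sin z)
  (continuous_within_derive (@is_derive_sin R)).
rewrite in_itv/= => /andP[xz zy].
have : 1 / 2 <= cos z by apply: cos_ge_half; rewrite ler_norml; apply/andP; split; lra.
have : 0 <= y - x by rewrite subr_ge0.
nra.
Qed.

End TrigEstimates.

(** * The boundary matrix *)

Section BoundaryMatrix.
Context (R : realType) (n : nat).
Variables alpha beta : 'I_n -> R.
Hypothesis lt_alpha_beta : forall i, alpha i < beta i.
Variable B : 'M[R[i]]_n.
Hypothesis uB : B \is unitarymx.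
Implicit Types (l : R[i]) (c k : 'cV[R[i]]_n) (x : 'I_n -> R).
Local Notation M := (Mlambda alpha beta B).

(** At [x = alpha] and [x = beta] these are the two boundary vectors of the exponential sum with
    coefficients [c]. *)
Definition exp_col l x c : 'cV[R[i]]_n :=
  \col_i (cexp (twopii * l * (x i)%:C) * c i 0).

Lemma mul_Ediag (v : 'I_n -> R[i]) c :
  Ediag v *m c = \col_i (cexp (v i) * c i 0).
Proof. by rewrite mul_diag_mx; apply/colP => i; rewrite !mxE. Qed.

(* The boundary condition for [e^(2 pi i l t) (c_i + d_i(t))], where [d_i] goes
   from [0] at [alpha_i] to [k_i] at [beta_i]. *)
Lemma Mlambda_mulP l c k :
  M l *m c = - k <-> B *m exp_col l alpha c = exp_col l beta (c + k).
Proof.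
set b := B *m exp_col l alpha c.
have -> : M l *m c = c - \col_i (cexp (- twopii * l * (beta i)%:C) * b i 0).
  rewrite /Mlambda mulmxBl mul1mx -!mulmxA (mul_Ediag _ c) -/b.
  by congr (_ - _); exact: mul_Ediag.
split=> [|bE].
  move=> /(congr1 (fun z => c - z)); rewrite opprB addrCA subrr addr0 opprK => h.
  apply/colP => i; move/colP/(_ i) : h; rewrite !mxE => <-.
  by rewrite mulNr mulNr mulrA cexpKN mul1r.
apply/colP => i; rewrite bE !mxE mulNr mulNr mulrA cexpNK mul1r.
by rewrite opprD addrA subrr add0r.
Qed.

Lemma Mlambda_kerP l c :
  M l *m c = 0 <-> B *m exp_col l alpha c = exp_col l beta c.
Proof. by have := Mlambda_mulP l c 0; rewrite oppr0 addr0. Qed.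

Lemma Lambda_BP l : Lambda_B alpha beta B l <-> exists2 c : 'cV[R[i]]_n, c != 0 & M l *m c = 0.
Proof.
rewrite /Lambda_B/= -(det_tr (M l)); split.
  move/eqP/det0P => [v v0 vM]; exists v^T; first by rewrite trmx_eq0.
  by rewrite -[M l]trmxK -trmx_mul vM trmx0.
move=> [c c0 cM]; apply/eqP/det0P; exists c^T; first by rewrite trmx_eq0.
by rewrite -trmx_mul cM trmx0.
Qed.

Lemma unitary_dot c k :
  \sum_i (B *m c) i 0 * Num.conj ((B *m k) i 0) = \sum_i c i 0 * Num.conj (k i 0).
Proof.
have dotE (a b : 'cV[R[i]]_n) :
    \sum_i a i 0 * Num.conj (b i 0) = (map_mx Num.conj b^T *m a) 0 0.
  by rewrite mxE; apply: eq_bigr => i _; rewrite !mxE mulrC.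
rewrite !dotE trmx_mul map_mxM -mulmxA [_ *m (B *m c)]mulmxA.
by have /mulmx1C -> := unitarymxP uB; rewrite mul1mx.
Qed.

(** This is the vanishing of the boundary form on two exponential sums: the unitary [B] maps their
    values at [alpha] to those at [beta] and preserves the scalar product. The product of one
    exponential with the conjugate of the other has frequency [l - conj l']. *)
Lemma kernel_identity l l' c c' : M l *m c = 0 -> M l' *m c' = 0 ->
  \sum_i c i 0 * Num.conj (c' i 0) *
    (cexp (twopii * (l - Num.conj l') * (beta i)%:C) -
     cexp (twopii * (l - Num.conj l') * (alpha i)%:C)) = 0.
Proof.
move=> /Mlambda_kerP h /Mlambda_kerP h'.
have := unitary_dot (exp_col l alpha c) (exp_col l' alpha c').
rewrite h h' => /eqP; rewrite -subr_eq0 -sumrB => /eqP S0.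
rewrite -[RHS]S0; apply: eq_bigr => i _.
have E x : exp_col l x c i 0 * Num.conj (exp_col l' x c' i 0) =
    c i 0 * Num.conj (c' i 0) * cexp (twopii * (l - Num.conj l') * (x i)%:C).
  rewrite !mxE (conjM (cexp _)) conj_phase.
  have -> : twopii * (l - Num.conj l') * (x i)%:C =
    twopii * l * (x i)%:C + - twopii * Num.conj l' * (x i)%:C by ring.
  by rewrite (cexpD (twopii * l * _)); ring.
by rewrite !E mulrBr.
Qed.

(** In [kernel_identity] with [l' = l] the exponents are real, and the differences of exponentials
    have the sign of [- Im l] for every interval at once. A sum of terms of one sign, one of them
    nonzero, cannot vanish. *)
Lemma Lambda_B_real l : Lambda_B alpha beta B l -> l = (Re l)%:C.
Proof.
move=> /Lambda_BP[c c0 cM]; apply: complex_eq => //=.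
have [i ci0] : exists i, c i 0 != 0.
  apply/existsP; apply: contraNT c0; rewrite negb_exists => /forallP c0.
  by apply/eqP/colP => i; rewrite mxE; apply/eqP; have := c0 i; rewrite negbK.
have := kernel_identity cM cM => /(congr1 (@Re R)); rewrite Re_sum/=.
pose k := 4 * pi * Im l.
have E j : Re (c j 0 * Num.conj (c j 0) *
    (cexp (twopii * (l - Num.conj l) * (beta j)%:C) -
     cexp (twopii * (l - Num.conj l) * (alpha j)%:C))) =
   normc (c j 0) ^+ 2 * (expR (- k * beta j) - expR (- k * alpha j)).
  have exE (x : R) : cexp (twopii * (l - Num.conj l) * x%:C) = (expR (- k * x))%:C.
    have -> : twopii * (l - Num.conj l) * x%:C = (- k * x)%:C.
      by apply: complex_eq; rewrite !ReIm/= /k; ring.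
    by apply: complex_eq; rewrite ?Re_cexp ?Im_cexp/= ?cos0 ?sin0 ?mulr1 ?mulr0.
  by rewrite !exE normc_def2 !ReIm/=; ring.
under eq_bigr do rewrite E.
have c2 j : 0 <= normc (c j 0) ^+ 2 by rewrite sqr_ge0.
have ci2 : 0 < normc (c i 0) ^+ 2.
  rewrite lt_neqAle c2 andbT eq_sym sqrf_eq0.
  by apply: contra ci0 => /eqP/eq0_normc/eqP.
have pi40 : 0 < 4 * pi :> R by rewrite mulr_gt0// pi_gt0.
case: (ltgtP (Im l) 0) => // l0 S0; exfalso.
- have k0 : k < 0 by rewrite /k pmulr_rlt0.
  have T j : expR (- k * alpha j) < expR (- k * beta j).
    by rewrite ltr_expR ltr_pM2l// oppr_gt0.
  suff : 0 < \sum_j normc (c j 0) ^+ 2 * (expR (- k * beta j) - expR (- k * alpha j)).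
    by rewrite S0 ltxx.
  rewrite (bigD1 i)//= ltr_pwDl//; first by rewrite mulr_gt0 ?subr_gt0.
  by apply: sumr_ge0 => j _; rewrite mulr_ge0 ?subr_ge0// ltW.
- have k0 : 0 < k by rewrite /k pmulr_rgt0.
  have T j : expR (- k * beta j) < expR (- k * alpha j).
    by rewrite ltr_expR ltr_nM2l// oppr_lt0.
  suff : \sum_j normc (c j 0) ^+ 2 * (expR (- k * beta j) - expR (- k * alpha j)) < 0.
    by rewrite S0 ltxx.
  rewrite (bigD1 i)//= ltr_nwDl//; first by rewrite pmulr_rlt0 ?subr_lt0.
  by apply: sumr_le0 => j _; rewrite mulr_ge0_le0 ?subr_le0// ltW.
Qed.

(** For real [t] both diagonal factors are unitary, hence so is [U = 1 - N]. Then [v^T U = v^T]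
    implies that [U] fixes the conjugate of [v]: left and right kernels of [N] correspond under
    conjugation, and orthogonality to the right kernel is the usual solvability condition. *)
Lemma Mlambda_fredholm (t : R) k :
  (forall c, M t%:C *m c = 0 -> \sum_i k i 0 * Num.conj (c i 0) = 0) ->
  exists c, M t%:C *m c = k.
Proof.
move=> kM; pose N := M t%:C.
pose U := 1%:M - N.
have Eu (s : R) x : Ediag (fun i => twopii * s%:C * (x i)%:C) \is unitarymx.
  apply/unitarymxP/matrixP => i j.
  rewrite mul_diag_mx !mxE -(eq_sym j) rmorphMn/=.
  case: eqP => [->|_]; last by rewrite mulr0n mulr0.
  by rewrite !mulr1n conj_phase conj_real !mulNr cexpKN.
have uU : U \is unitarymx.
  have -> : U = Ediag (fun i => twopii * (- t)%:C * (beta i)%:C) *m B *m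
      Ediag (fun i => twopii * t%:C * (alpha i)%:C).
    rewrite /U /N /Mlambda subKr; congr (Ediag _ *m _ *m _); apply/funext => i.
    by rewrite rmorphN/= mulrN !mulNr.
  exact: (mul_unitarymx (mul_unitarymx (Eu (- t) beta) uB) (Eu t alpha)).
have /submxP[D kD] : (k^T <= N^T)%MS.
  rewrite submxE; apply/eqP/rowP => j; rewrite [RHS]mxE.
  (* The columns of the cokernel of [N^T] are transposes of left kernel vectors of [N]; [k] lies in
     the range once it is annihilated by all of them. *)
  set v := col j (cokermx N^T).
  have vN : v^T *m N = 0.
    by rewrite -[N]trmxK -trmx_mul /v colE mulmxA mulmx_coker mul0mx trmx0.
  have vU : v^T *m U = v^T by rewrite /U mulmxBr mulmx1 vN subr0.
  have Uv : N *m map_mx Num.conj v = 0.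
    have : v^T = v^T *m map_mx Num.conj U^T.
      by rewrite -{2}vU -mulmxA (unitarymxP uU) mulmx1.
    move/(congr1 (fun z => map_mx Num.conj z^T)).
    rewrite trmx_mul trmxK map_mxM => h.
    have UE : map_mx Num.conj (map_mx Num.conj U^T)^T = U.
      by apply/matrixP => a b; rewrite !mxE conjCK.
    have -> : N = 1%:M - U by rewrite /U opprB addrC subrK.
    rewrite UE in h; apply/eqP; rewrite mulmxBl mul1mx subr_eq0.
    exact/eqP.
  rewrite mxE -[RHS](kM _ Uv); apply: eq_bigr => i _.
  by rewrite !mxE conjCK.
exists D^T; rewrite -[k]trmxK kD trmx_mul trmxK//.
Qed.

(* Two normalized kernel vectors that are close to each other cannot belong to
   close but distinct points: the boundary form would not vanish. *)
Lemma close_kernel (T L : R) (s t : R) (c d : 'cV[R[i]]_n) :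
  (forall i, `|alpha i| <= T /\ `|beta i| <= T) ->
  L = \sum_i (beta i - alpha i) ->
  \sum_i normc (c i 0) ^+ 2 * (beta i - alpha i) = 1 ->
  M t%:C *m c = 0 -> M s%:C *m d = 0 -> s <= t ->
  2 * pi * (t - s) * T <= 1 ->
  (forall i, `|Re (d i 0) - Re (c i 0)| <= (8 * (L + 1))^-1) ->
  (forall i, `|Im (d i 0) - Im (c i 0)| <= (8 * (L + 1))^-1) ->
  s = t.
Proof.
move=> hT LE c1 cM dM; rewrite le_eqVlt => /predU1P[//|st] dT dRe dIm; exfalso.
set e := _^-1 in dRe dIm.
have len i : 0 < beta i - alpha i by rewrite subr_gt0.
have L0 : 0 <= L by rewrite LE sumr_ge0// => i _; exact: ltW.
have eL : e * (L + 1) = 8^-1.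
  by rewrite /e invfM -mulrA mulVf ?mulr1// gt_eqF// ltr_wpDl.
have e0 : 0 < e by rewrite /e invr_gt0 mulr_gt0// ltr_wpDl.
pose th := 2 * pi * (t - s).
have th0 : 0 < th by rewrite !mulr_gt0 ?pi_gt0// subr_gt0.
have thT (x : R) : `|x| <= T -> `|th * x| <= 1.
  by move=> xT; rewrite normrM gtr0_norm// (le_trans _ dT)// ler_wpM2l// ltW.
have := kernel_identity cM dM => /(congr1 (@Im R)); rewrite Im_sum/= => S0.
(* For [d = c] each term of the boundary form would be at least [th (beta i - alpha i) / 2] times
   the squared modulus of [c i]; the error [d - c] costs the second term. By the normalization of
   [c] the sum of these bounds is [th (1/2 - 2 e (L + 1))], which is [th / 4] as
   [e = 1 / (8 (L + 1))]: a contradiction. *)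
have : \sum_i th * ((beta i - alpha i) / 2 * normc (c i 0) ^+ 2
     - 2 * e * (beta i - alpha i) * (1 + normc (c i 0) ^+ 2)) <= 0.
  rewrite -[leRHS]S0; apply: ler_sum => i _.
  have [/thT aT /thT bT] := hT i.
  have ab : th * alpha i <= th * beta i by rewrite ler_pM2l// ltW.
  have h1 := sinB_ge ab aT bT; have h2 := sinB_le ab; have h3 := cosB_le ab.
  have exE (x : R) : cexp (twopii * (t%:C - Num.conj s%:C) * x%:C) =
      cos (th * x) +i* sin (th * x).
    have -> : twopii * (t%:C - Num.conj s%:C) * x%:C = 0 +i* (th * x).
      by apply: complex_eq; rewrite !ReIm/= /th; ring.
    by apply: complex_eq; rewrite ?Re_cexp ?Im_cexp/= expR0 mul1r.
  rewrite !exE normc_def2 !ReIm/=.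
  move: (dRe i) (dIm i) (len i) h1 h2 h3.
  case: (c i 0) => a b; case: (d i 0) => a' b' /=.
  set ds := sin _ - sin _; set dc := cos _ - cos _; set l := beta i - alpha i.
  have -> : th * beta i - th * alpha i = th * l by rewrite mulrBr.
  set K := th * l => dx dy l0 h1 h2 h3; have K0 : 0 < K by rewrite mulr_gt0.
  pose x := a' - a; pose y := b' - b.
  have e0' := ltW e0; have K0' := ltW K0.
  have prod_le (u v w z : R) : `|w| <= e -> `|z| <= K -> `|u * w * z| <= `|u| * e * K.
    by move=> we zK; rewrite !normrM ler_pM// ?mulr_ge0// ler_wpM2l.
  have le_sqr (u : R) : `|u| <= (1 + u ^+ 2) / 2.
    by rewrite -(real_normK (num_real u)); have := sqr_ge0 (`|u| - 1); nra.
  have f1 : 0 <= (a ^+ 2 + b ^+ 2) * (ds - K / 2).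
    by apply: mulr_ge0; rewrite ?subr_ge0// addr_ge0 ?sqr_ge0.
  have /ler_normlP[f2 _] := prod_le a a x ds dx h2.
  have /ler_normlP[f3 _] := prod_le b b y ds dy h2.
  have /ler_normlP[f4 _] := prod_le b b x dc dx h3.
  have /ler_normlP[_ f5] := prod_le a a y dc dy h3.
  have f6 : (`|a| + `|b|) * e * K <= (1 + (a ^+ 2 + b ^+ 2)) * e * K.
    do 2 apply: ler_wpM2r => //; have := le_sqr a; have := le_sqr b.
    by have := sqr_ge0 a; have := sqr_ge0 b; lra.
  have -> : th * (l / 2 * (a ^+ 2 + b ^+ 2) - 2 * e * l * (1 + (a ^+ 2 + b ^+ 2))) =
      (a ^+ 2 + b ^+ 2) * (K / 2) - 2 * ((1 + (a ^+ 2 + b ^+ 2)) * e * K).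
    by rewrite /K; ring.
  move: f1 f2 f3 f4 f5 f6; rewrite /x /y; lra.
rewrite -mulr_sumr pmulr_rle0// sumrB => h.
have : 2^-1 - 2 * e * (L + 1) <= 0.
  apply: le_trans h; rewrite le_eqVlt; apply/orP; left; apply/eqP.
  congr (_ - _).
    rewrite -[LHS]mul1r -c1 mulr_suml; apply: eq_bigr => i _; ring.
  have -> : L + 1 = \sum_i (beta i - alpha i) * (1 + normc (c i 0) ^+ 2).
    under eq_bigr do rewrite mulrDr mulr1 [X in _ + X]mulrC.
    by rewrite big_split/= c1 LE.
  by rewrite mulr_sumr; apply: eq_bigr => i _; rewrite mulrA.
have := eL; lra.
Qed.

Lemma countable_Lambda_B : countable [set t : R | Lambda_B alpha beta B t%:C].
Proof.
pose L := \sum_i (beta i - alpha i).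
pose T := 1 + \sum_i (`|alpha i| + `|beta i|).
have len i : 0 < beta i - alpha i by rewrite subr_gt0.
have L0 : 0 <= L by rewrite /L sumr_ge0// => i _; exact: ltW.
have T1 : 0 < T.
  by rewrite /T ltr_pwDl// sumr_ge0// => i _; rewrite addr_ge0.
have hT i : `|alpha i| <= T /\ `|beta i| <= T.
  rewrite /T (bigD1 i)//=; set X := \sum_(_ | _) _.
  have X0 : 0 <= X by apply: sumr_ge0 => j _; rewrite addr_ge0.
  have := normr_ge0 (alpha i); have := normr_ge0 (beta i).
  by split; lra.
have [c hc] : {c : R -> 'cV[R[i]]_n & forall t, Lambda_B alpha beta B t%:C ->
    M t%:C *m c t = 0 /\ \sum_i normc (c t i 0) ^+ 2 * (beta i - alpha i) = 1}.
  apply: (@choice _ _ (fun t (c : 'cV[R[i]]_n) => Lambda_B alpha beta B t%:C ->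
    M t%:C *m c = 0 /\ \sum_i normc (c i 0) ^+ 2 * (beta i - alpha i) = 1)) => t.
  have [tL|tL] := pselect (Lambda_B alpha beta B t%:C); last by exists 0.
  have [c c0 cM] := (Lambda_BP t%:C).1 tL.
  have [i ci0] : exists i, c i 0 != 0.
    apply/existsP; apply: contraNT c0; rewrite negb_exists => /forallP c0.
    by apply/eqP/colP => i; rewrite mxE; apply/eqP; have := c0 i; rewrite negbK.
  pose m := \sum_i normc (c i 0) ^+ 2 * (beta i - alpha i).
  have m0 : 0 < m.
    rewrite /m (bigD1 i)//= ltr_pwDl//.
      rewrite mulr_gt0// exprn_gt0// lt_neqAle normc_ge0 andbT eq_sym.
      by apply: contra ci0 => /eqP/eq0_normc/eqP.
    by apply: sumr_ge0 => j _; rewrite mulr_ge0// ?sqr_ge0// ltW.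
  exists ((Num.sqrt m)^-1%:C *: c) => _; split.
    by rewrite -scalemxAr cM scaler0.
  transitivity (m / m); last by rewrite mulfV ?lt0r_neq0.
  transitivity ((\sum_j normc (c j 0) ^+ 2 * (beta j - alpha j)) / m) => //.
  rewrite mulr_suml.
  apply: eq_bigr => j _; rewrite mxE normcM exprMn [normc _%:C ^+ 2]normc_def2/=.
  have sm : (Num.sqrt m)^-1 ^+ 2 = m^-1 by rewrite exprVn sqr_sqrtr// ltW.
  by rewrite expr0n/= addr0 sm; ring.
pose fl (d x : R) : int := Num.floor (x / d).
have flP (d x y : R) : 0 < d -> fl d x = fl d y -> `|x - y| <= d.
  move=> d0 xy; have := floor_itv (x / d); have := floor_itv (y / d).
  rewrite -/(fl d x) -/(fl d y) xy intrD ler_pdivlMr// ltr_pdivrMr//.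
  rewrite ler_pdivlMr// ltr_pdivrMr// => /andP[h1 h2] /andP[h3 h4].
  by rewrite ler_norml; apply/andP; split; lra.
(* These mesh sizes are the tolerances of [close_kernel], so that points with the same code
   coincide. The codes lie in a countable type. *)
pose h := (2 * pi * T)^-1; pose e := (8 * (L + 1))^-1.
have h0 : 0 < h by rewrite invr_gt0 !mulr_gt0 ?pi_gt0.
have e0 : 0 < e by rewrite invr_gt0 mulr_gt0// ltr_wpDl.
pose code t := (fl h t, [ffun i => (fl e (Re (c t i 0)), fl e (Im (c t i 0)))]).
apply/countable_injP; exists (fun t => pickle (code t)) => s t.
move=> /set_mem sL /set_mem tL /(pcan_inj pickleK) E.
have /(flP _ _ _ h0) st := congr1 fst E.
have /ffunP cst := congr1 snd E; rewrite /code /= in cst; clear E.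
wlog le_st : s t sL tL st cst / s <= t.
  move=> wl; have [/wl|/ltW/wl ts] := leP s t; first by apply.
  by apply/esym/ts => //; rewrite 1?distrC// => i; rewrite cst.
have [sM _] := hc _ sL; have [tM t1] := hc _ tL.
apply: (close_kernel hT erefl t1 tM sM le_st).
- rewrite distrC ger0_norm ?subr_ge0// in st.
  rewrite mulrAC -ler_pdivlMl ?mulr_gt0 ?pi_gt0// mulr1 -/h//.
- by move=> i; have := cst i; rewrite !ffunE => -[+ _]; exact: flP.
- by move=> i; have := cst i; rewrite !ffunE => -[_]; exact: flP.
Qed.

End BoundaryMatrix.

(** * Complex-valued square integrable functions *)

Section ComplexIntegral.
Context d (T : measurableType d) (R : realType).
Variable mu : {measure set T -> \bar R}.
Implicit Types (f g w : T -> R[i]) (h : T -> R).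
Local Notation rintegrable h := (mu.-integrable setT (EFin \o h)).

Definition cintegrable w :=
  rintegrable (fun x => Re (w x)) /\ rintegrable (fun x => Im (w x)).

Definition cint w : R[i] :=
  (\int[mu]_x Re (w x)) +i* (\int[mu]_x Im (w x)).

(** Real and imaginary parts of [a * f + g] with complex [a] both have this shape. *)
Lemma rintegrable_comb (a b : R) h1 h2 h3 :
  rintegrable h1 -> rintegrable h2 -> rintegrable h3 ->
  rintegrable (fun x => a * h1 x + b * h2 x + h3 x).
Proof.
move=> i1 i2 i3.
have := integrableD measurableT (integrableD measurableT
  (integrableZl measurableT a i1) (integrableZl measurableT b i2)) i3.
by apply: eq_integrable => // x _ /=.
Qed.

Lemma Rintegral_comb (a b : R) h1 h2 h3 :
  rintegrable h1 -> rintegrable h2 -> rintegrable h3 ->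
  \int[mu]_x (a * h1 x + b * h2 x + h3 x) =
  a * \int[mu]_x h1 x + b * \int[mu]_x h2 x + \int[mu]_x h3 x.
Proof.
move=> i1 i2 i3.
have ia : rintegrable (fun x => a * h1 x).
  by have := integrableZl measurableT a i1; apply: eq_integrable.
have ib : rintegrable (fun x => b * h2 x).
  by have := integrableZl measurableT b i2; apply: eq_integrable.
rewrite RintegralD// ?RintegralD// ?RintegralZl//.
by have := integrableD measurableT ia ib; apply: eq_integrable.
Qed.

Lemma cint_comb (a : R[i]) f g : cintegrable f -> cintegrable g ->
  cint (fun x => a * f x + g x) = a * cint f + cint g.
Proof.
move=> [f1 f2] [g1 g2]; apply: complex_eq; rewrite !ReIm/=.
  rewrite -mulNr -Rintegral_comb//; apply: eq_Rintegral => x _.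
  by rewrite !ReIm mulNr.
by rewrite -Rintegral_comb//; apply: eq_Rintegral => x _; rewrite !ReIm.
Qed.

Lemma cint_conj f : cintegrable f ->
  cint (fun x => Num.conj (f x)) = Num.conj (cint f).
Proof.
move=> [_ f2]; apply: complex_eq; rewrite !ReIm/=.
  by apply: eq_Rintegral => x _; rewrite ReJ.
rewrite -mulN1r -RintegralZl//; apply: eq_Rintegral => x _.
by rewrite ImJ mulN1r.
Qed.

End ComplexIntegral.

Section L2Facts.
Context d (T : measurableType d) (R : realType).
Variable mu : {measure set T -> \bar R}.
Implicit Types (f g : T -> R[i]) (u v : L2 mu).

Lemma Lfun2P (h : T -> R) : measurable_fun setT h ->
  (\int[mu]_x (h x ^+ 2)%:E < +oo)%E -> h \in Lfun mu 2%:E.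
Proof.
move=> mh h2; rewrite inE; apply/andP; split; rewrite inE//=.
rewrite /finite_norm unlock poweR_lty//.
by under eq_integral do rewrite /= powR_mulrn// real_normK ?num_real//.
Qed.

Lemma L2pred_measurable f : f \in L2pred mu ->
  measurable_fun setT (fun x => Re (f x)) /\ measurable_fun setT (fun x => Im (f x)).
Proof. by case/andP => /andP[/[!inE]/= m1 _] /andP[/[!inE]/= m2 _]. Qed.

Lemma L2pred_mul f g : f \in L2pred mu -> g \in L2pred mu ->
  cintegrable mu (fun x => f x * Num.conj (g x)).
Proof.
move=> /andP[f1 f2] /andP[g1 g2].
have i (h k : T -> R) : h \in Lfun mu 2%:E -> k \in Lfun mu 2%:E ->
    mu.-integrable setT (EFin \o (fun x => h x * k x)).
  by move=> hL kL; apply/Lfun1_integrable; exact: Lfun2_mul_Lfun1.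
split.
  have := rintegrable_comb 1 0 (i _ _ f1 g1) (i _ _ f1 g1) (i _ _ f2 g2).
  by apply: eq_integrable => // x _ /=; rewrite !ReIm; congr EFin; ring.
have := rintegrable_comb 1 (-1) (i _ _ f2 g1) (i _ _ f1 g2) (i _ _ f1 g2).
have := rintegrable_comb (-1) 0 (i _ _ f1 g2) (i _ _ f1 g1) (i _ _ f2 g1).
move=> h _; move: h.
by apply: eq_integrable => // x _ /=; rewrite !ReIm; congr EFin; ring.
Qed.

Lemma is_class_of_repr u : is_class_of u (repr u).
Proof. exact: aeW. Qed.

Lemma repr_L2pred u : (repr u : T -> R[i]) \in L2pred mu.
Proof. by case: (repr u). Qed.

Lemma is_class_of_uniq u v f : is_class_of u f -> is_class_of v f -> u = v.
Proof.
move=> uf vf; rewrite -[u]reprK -[v]reprK; apply/eqP.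
rewrite -Quotient.idealrBE; apply/asboolP.
apply: filterS2 uf vf => x uf vf.
by rewrite -[LHS]/(repr u x - repr v x) uf vf subrr.
Qed.

Lemma is_class_of_ae u f g : is_class_of u f -> is_class_of u g ->
  {ae mu, forall x, f x = g x}.
Proof. by apply: filterS2 => x <- <-. Qed.

Lemma is_class_of_eq u f g : is_class_of u f ->
  {ae mu, forall x, f x = g x} -> is_class_of u g.
Proof. by apply: filterS2 => x -> ->. Qed.

Lemma is_class_of_ext u f g : f =1 g -> is_class_of u f -> is_class_of u g.
Proof. by move=> fg; apply: filterS => x ->. Qed.

Lemma is_class_of_pi (f : L2fun mu) : is_class_of (\pi_(L2 mu)%qT f) f.
Proof.
have : (repr (\pi_(L2 mu)%qT f) - f \in @L2null _ _ _ mu).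
  by rewrite Quotient.idealrBE reprK.
move=> /asboolP; apply: filterS => x.
rewrite -[_ x]/(repr (\pi_(L2 mu)%qT f) x - f x) => /eqP.
by rewrite subr_eq0 => /eqP.
Qed.

Lemma is_class_of_exists f : f \in L2pred mu -> exists u, is_class_of u f.
Proof. by move=> fL; exists (\pi_(L2 mu)%qT (MkL2fun fL)); exact: is_class_of_pi. Qed.

Lemma is_class_of_comb (a : R[i]) u v f g : is_class_of u f -> is_class_of v g ->
  is_class_of (a *: u + v) (fun x => a * f x + g x).
Proof.
move=> uf vg.
have -> : a *: u + v = \pi_(L2 mu)%qT (a *: repr u + repr v : L2fun mu).
  by rewrite -[u in LHS]reprK -[v in LHS]reprK -L2pi_add -L2scale_pi.
have h := is_class_of_pi (a *: repr u + repr v : L2fun mu).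
apply: is_class_of_eq h _; apply: filterS2 uf vg => x uf vg.
by rewrite -[LHS]/(a * repr u x + repr v x) uf vg.
Qed.

Lemma is_class_of0 : is_class_of (0 : L2 mu) (fun=> 0).
Proof.
have h := is_class_of_pi (0 : L2fun mu).
have := is_class_of_comb (-1) h h; rewrite scaleN1r addNr.
by apply: is_class_of_ext => x; rewrite -[(0 : L2fun mu) x]/0 mulr0 addr0.
Qed.

Lemma is_class_of_scale (a : R[i]) u f : is_class_of u f ->
  is_class_of (a *: u) (fun x => a * f x).
Proof.
move=> uf; have := is_class_of_comb a uf is_class_of0; rewrite addr0.
by apply: is_class_of_ext => x; rewrite addr0.
Qed.

Lemma is_class_of_sub u v f g : is_class_of u f -> is_class_of v g ->
  is_class_of (u - v) (fun x => f x - g x).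
Proof.
move=> uf vg; have := is_class_of_comb (-1) vg uf; rewrite scaleN1r addrC.
by apply: is_class_of_ext => x; rewrite mulN1r addrC.
Qed.

Lemma is_class_of_sum (I : Type) (r : seq I) (F : I -> L2 mu) (f : I -> T -> R[i]) :
  (forall i, is_class_of (F i) (f i)) ->
  is_class_of (\sum_(i <- r) F i) (fun x => \sum_(i <- r) f i x).
Proof.
move=> Ff; elim: r => [|i r IH].
  by rewrite big_nil; apply: is_class_of_ext is_class_of0 => x; rewrite big_nil.
rewrite big_cons -[F i]scale1r; apply: is_class_of_ext (is_class_of_comb 1 (Ff i) IH) => x.
by rewrite big_cons mul1r.
Qed.

Lemma L2ip_class u v f g : f \in L2pred mu -> g \in L2pred mu ->
  is_class_of u f -> is_class_of v g ->
  L2ip u v = cint mu (fun x => f x * Num.conj (g x)).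
Proof.
move=> fL gL uf vg.
have [m1 m2] := L2pred_mul (repr_L2pred u) (repr_L2pred v).
have [m3 m4] := L2pred_mul fL gL.
apply: complex_eq => /=; congr fine; apply: ae_eq_integral => //;
  (try exact: (measurable_int mu)); apply: filterS2 uf vg => x -> -> //.
Qed.

Lemma L2ip_inner_product : inner_product (@L2ip d T R mu).
Proof.
split.
- move=> a u v w.
  have uv : (fun x => a * repr u x + repr v x) \in L2pred mu.
    have := repr_L2pred (a *: u + v); have [_ H] := L2pred_submod_closed mu.
    by move=> _; exact: (H a _ _ (repr_L2pred u) (repr_L2pred v)).
  rewrite (L2ip_class uv (repr_L2pred w)
    (is_class_of_comb a (is_class_of_repr u) (is_class_of_repr v)) (is_class_of_repr w)).
  rewrite -cint_comb; last 2 first.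
  - exact: L2pred_mul (repr_L2pred u) (repr_L2pred w).
  - exact: L2pred_mul (repr_L2pred v) (repr_L2pred w).
  by congr cint; apply/funext => x; rewrite mulrDl mulrA.
- move=> u v; rewrite /L2ip -/(cint mu _) -/(cint mu _) -cint_conj; last first.
    exact: L2pred_mul (repr_L2pred u) (repr_L2pred v).
  by congr cint; apply/funext => x; rewrite conjM conjCK mulrC.
- move=> u; apply: Rintegral_ge0 => x _.
  by rewrite !ReIm mulrN opprK addr_ge0// -expr2 sqr_ge0.
- move=> u u0; apply: is_class_of_uniq is_class_of0.
  have [i1 _] := L2pred_mul (repr_L2pred u) (repr_L2pred u).
  have p x : 0 <= Re (repr u x * Num.conj (repr u x)).
    by rewrite !ReIm mulrN opprK addr_ge0// -expr2 sqr_ge0.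
  have : (\int[mu]_x `|(Re (repr u x * Num.conj (repr u x)))%:E| = 0)%E.
    under eq_integral do rewrite gee0_abs ?lee_fin//.
    by rewrite -[LHS]fineK ?integrable_fin_num//; congr EFin.
  move/(ae_eq_integral_abs mu measurableT (measurable_int mu i1)).
  apply: filterS => x /(_ I)[]; rewrite !ReIm mulrN opprK -!expr2 => /eqP.
  rewrite paddr_eq0 ?sqr_ge0// !sqrf_eq0 => /andP[/eqP r0 /eqP i0].
  exact: complex_eq.
Qed.

End L2Facts.

(** * Calculus for complex functions of a real variable *)

Section ComplexCalculus.
Context (R : realType).
Implicit Types (f g F : R -> R[i]) (x a b : R) (z w : R[i]).

Definition is_cderive x f z :=
  is_derive x 1 (fun t => Re (f t)) (Re z) /\
  is_derive x 1 (fun t => Im (f t)) (Im z).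

Lemma scale_regular (c d : R) : c *: (d : R^o) = c * d. Proof. by []. Qed.

Lemma is_cderiveM x f g df dg : is_cderive x f df -> is_cderive x g dg ->
  is_cderive x (fun t => f t * g t) (df * g x + f x * dg).
Proof.
move=> [f1 f2] [g1 g2]; split.
  rewrite (_ : (fun t => Re (f t * g t)) =
    (fun t => Re (f t)) * (fun t => Re (g t)) - (fun t => Im (f t)) * (fun t => Im (g t))).
    apply: (is_derive_eq (is_deriveB (is_deriveM f1 g1) (is_deriveM f2 g2))).
    by rewrite !ReIm !scale_regular; ring.
  by apply/funext => t; rewrite ReM.
rewrite (_ : (fun t => Im (f t * g t)) =
  (fun t => Re (f t)) * (fun t => Im (g t)) + (fun t => Im (f t)) * (fun t => Re (g t))).
  apply: (is_derive_eq (is_deriveD (is_deriveM f1 g2) (is_deriveM f2 g1))).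
  by rewrite !ReIm !scale_regular; ring.
by apply/funext => t; rewrite ImM.
Qed.

Lemma is_cderiveD x f g df dg : is_cderive x f df -> is_cderive x g dg ->
  is_cderive x (fun t => f t + g t) (df + dg).
Proof.
move=> [f1 f2] [g1 g2]; split.
  rewrite (_ : (fun t => Re (f t + g t)) = (fun t => Re (f t)) + (fun t => Re (g t))).
    by rewrite ReD; exact: is_deriveD.
  by apply/funext => t; rewrite ReD.
rewrite (_ : (fun t => Im (f t + g t)) = (fun t => Im (f t)) + (fun t => Im (g t))).
  by rewrite ImD; exact: is_deriveD.
by apply/funext => t; rewrite ImD.
Qed.

Lemma is_cderive_cst x z : is_cderive x (fun=> z) 0.
Proof. by split; exact: is_derive_cst. Qed.

Lemma is_cderive_conj x f df : is_cderive x f df ->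
  is_cderive x (fun t => Num.conj (f t)) (Num.conj df).
Proof.
move=> [f1 f2]; split.
  by rewrite (_ : (fun t => _) = fun t => Re (f t)) ?ReJ//; apply/funext => t; rewrite ReJ.
rewrite (_ : (fun t => _) = - (fun t => Im (f t))); last by apply/funext => t; rewrite ImJ.
by rewrite ImJ; exact: is_deriveN.
Qed.

Lemma is_derive_lin (c x : R) : is_derive x 1 (fun t => c * t) c.
Proof.
have -> : (fun t : R => c * t) = cst c * id by [].
by apply: is_derive_eq; rewrite scaler0 addr0 scale_regular mulr1.
Qed.

Lemma is_cderive_cexp x z :
  is_cderive x (fun t => cexp (z * t%:C)) (z * cexp (z * x%:C)).
Proof.
have E t : cexp (z * t%:C) =
    (expR (Re z * t) * cos (Im z * t)) +i* (expR (Re z * t) * sin (Im z * t)).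
  by apply: complex_eq; rewrite ?Re_cexp ?Im_cexp !ReIm/= !mulr0 subr0 add0r.
have dz := is_derive_lin (Re z) x; have dw := is_derive_lin (Im z) x.
have de : is_derive x 1 (fun t => expR (Re z * t)) (expR (Re z * x) * Re z).
  exact: (is_derive1_comp (is_derive_expR _) dz).
have dc : is_derive x 1 (fun t => cos (Im z * t)) (- sin (Im z * x) * Im z).
  exact: (is_derive1_comp (is_derive_cos _) dw).
have ds : is_derive x 1 (fun t => sin (Im z * t)) (cos (Im z * x) * Im z).
  exact: (is_derive1_comp (is_derive_sin _) dw).
split.
  rewrite (_ : (fun t => _) = (fun t => expR (Re z * t)) * (fun t => cos (Im z * t))).
    by apply: is_derive_eq; rewrite ReM E !scale_regular/=; ring.
  by apply/funext => t; rewrite E.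
rewrite (_ : (fun t => _) = (fun t => expR (Re z * t)) * (fun t => sin (Im z * t))).
  by apply: is_derive_eq; rewrite ImM E !scale_regular/=; ring.
by apply/funext => t; rewrite E.
Qed.

Lemma cderivable_is_cderive f x : cderivable f x -> is_cderive x f (cderive f x).
Proof.
move=> [d1 d2]; split; rewrite /cderive /= derive1E.
  exact: (derivableP d1).
exact: (derivableP d2).
Qed.

Lemma smooth_cderivable f : smooth f ->
  forall x, cderivable f x /\ cderivable (cderive f) x.
Proof. by move=> sf x; split; [exact: (sf 0%N x)|have := sf 1%N x; rewrite !derive1n1]. Qed.

Definition ccont_on a b f :=
  {within `[a, b], continuous (fun t => Re (f t))} /\
  {within `[a, b], continuous (fun t => Im (f t))}.

Lemma within_continuous_comb (D : set R) (c d : R) (h1 h2 h3 h4 : R -> R) :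
  {within D, continuous h1} -> {within D, continuous h2} ->
  {within D, continuous h3} -> {within D, continuous h4} ->
  {within D, continuous (fun t => c * (h1 t * h2 t) + d * (h3 t * h4 t))}.
Proof.
move=> k1 k2 k3 k4 x; apply: (@cvgD _ R^o); apply: cvgM; try exact: cvg_cst.
  by apply: cvgM; [exact: k1|exact: k2].
by apply: cvgM; [exact: k3|exact: k4].
Qed.

Lemma ccont_onM a b f g : ccont_on a b f -> ccont_on a b g ->
  ccont_on a b (fun t => f t * g t).
Proof.
move=> [f1 f2] [g1 g2]; split.
  rewrite (_ : (fun t => _) = fun t => 1 * (Re (f t) * Re (g t)) + (-1) * (Im (f t) * Im (g t))).
    exact: within_continuous_comb.
  by apply/funext => t; rewrite ReM mul1r mulN1r.
rewrite (_ : (fun t => _) = fun t => 1 * (Re (f t) * Im (g t)) + 1 * (Im (f t) * Re (g t))).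
  exact: within_continuous_comb.
by apply/funext => t; rewrite ImM !mul1r.
Qed.

Lemma ccont_onD a b f g : ccont_on a b f -> ccont_on a b g ->
  ccont_on a b (fun t => f t + g t).
Proof.
move=> [f1 f2] [g1 g2]; split.
  rewrite (_ : (fun t => Re (f t + g t)) = fun t => Re (f t) + Re (g t)); last first.
    by apply/funext => t; rewrite ReD.
  by move=> x; apply: (@cvgD _ R^o); [exact: f1|exact: g1].
rewrite (_ : (fun t => Im (f t + g t)) = fun t => Im (f t) + Im (g t)); last first.
  by apply/funext => t; rewrite ImD.
by move=> x; apply: (@cvgD _ R^o); [exact: f2|exact: g2].
Qed.

Lemma ccont_on_cst a b z : ccont_on a b (fun=> z).
Proof. by split=> x; exact: cvg_cst. Qed.

Lemma ccont_on_conj a b f : ccont_on a b f -> ccont_on a b (fun t => Num.conj (f t)).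
Proof.
move=> [f1 f2]; split; first by rewrite (_ : (fun t => _) = fun t => Re (f t)) //;
  apply/funext => t; rewrite ReJ.
rewrite (_ : (fun t => Im (Num.conj (f t))) = fun t => - Im (f t)); last first.
  by apply/funext => t; rewrite ImJ.
by move=> x; apply: (@cvgN _ R^o); exact: f2.
Qed.

Lemma ccont_on_derive a b f df : (forall x, is_cderive x f (df x)) -> ccont_on a b f.
Proof.
by move=> fd; split; [apply: (@continuous_within_derive _ _ (fun x => Re (df x)))|
  apply: (@continuous_within_derive _ _ (fun x => Im (df x)))] => x; have [] := fd x.
Qed.

Lemma ccont_on_cexp a b z : ccont_on a b (fun t => cexp (z * t%:C)).
Proof.
exact: (@ccont_on_derive _ _ _ (fun x => z * cexp (z * x%:C)) (fun x => is_cderive_cexp x z)).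
Qed.

Lemma within_bounded a b (h : R -> R) : {within `[a, b], continuous h} ->
  exists2 K, 0 <= K & forall t, t \in `[a, b] -> `|h t| <= K.
Proof.
move=> hc; have [ab|ba] := leP a b; last first.
  by exists 0 => // t; rewrite in_itv/= => /andP[/le_trans h1 /h1]; rewrite leNgt ba.
have [c _ hM] := EVT_max ab hc.
have hNc : {within `[a, b], continuous (fun t => - h t)}.
  by move=> x; apply: (@cvgN _ R^o); exact: hc.
have [d _ hm] := EVT_max ab hNc.
exists (`|h c| + `|h d|) => [|t tab]; first exact: addr_ge0.
rewrite ler_norml; apply/andP; split.
  have := hm t tab; have := ler_norm (- h d); rewrite normrN.
  have := normr_ge0 (h c); lra.
have := hM t tab; have := ler_norm (h c); have := normr_ge0 (h d); lra.
Qed.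

Lemma ccont_on_bounded a b f : ccont_on a b f ->
  exists2 K, 0 <= K & forall t, t \in `[a, b] -> normc (f t) <= K.
Proof.
move=> [/within_bounded[K K0 fK] /within_bounded[L L0 fL]].
exists (K + L) => [|t tab]; first exact: addr_ge0.
by rewrite (le_trans (normc_le_ReIm _))// lerD ?fK ?fL.
Qed.

Definition cint_itv a b f : R[i] :=
  (\int[lebesgue_measure]_(x in `[a, b]) Re (f x)) +i*
  (\int[lebesgue_measure]_(x in `[a, b]) Im (f x)).

Definition cint_able a b f :=
  lebesgue_measure.-integrable `[a, b] (EFin \o (fun t => Re (f t))) /\
  lebesgue_measure.-integrable `[a, b] (EFin \o (fun t => Im (f t))).

Lemma ccont_on_integrable a b f : ccont_on a b f -> cint_able a b f.
Proof.
by move=> [f1 f2]; split; apply: continuous_compact_integrable => //;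
  exact: segment_compact.
Qed.

(** Here [df] is a function of its own, continuous on the closed interval and equal to the
    derivative of [f] inside. This is the form required by the fundamental theorem of calculus,
    whatever [f] does outside the interval. *)
Record C1_on a b f df : Prop := {
  C1_cont : ccont_on a b f ;
  C1_dcont : ccont_on a b df ;
  C1_derive : forall x, x \in `]a, b[ -> is_cderive x f (df x) }.

Lemma C1_onM a b f df g dg : C1_on a b f df -> C1_on a b g dg ->
  C1_on a b (fun t => f t * g t) (fun t => df t * g t + f t * dg t).
Proof.
move=> [cf cdf fd] [cg cdg gd]; split; first exact: ccont_onM.
  by apply: ccont_onD; exact: ccont_onM.
by move=> x xab; apply: is_cderiveM; [exact: fd|exact: gd].
Qed.

Lemma C1_on_conj a b f df : C1_on a b f df ->
  C1_on a b (fun t => Num.conj (f t)) (fun t => Num.conj (df t)).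
Proof.
move=> [cf cdf fd]; split; [exact: ccont_on_conj|exact: ccont_on_conj|].
by move=> x xab; apply: is_cderive_conj; exact: fd.
Qed.

Lemma C1_onD a b f df g dg : C1_on a b f df -> C1_on a b g dg ->
  C1_on a b (fun t => f t + g t) (fun t => df t + dg t).
Proof.
move=> [cf cdf fd] [cg cdg gd]; split; [exact: ccont_onD|exact: ccont_onD|].
by move=> x xab; apply: is_cderiveD; [exact: fd|exact: gd].
Qed.

Lemma C1_on_cst a b z : C1_on a b (fun=> z) (fun=> 0).
Proof.
by split; [exact: ccont_on_cst|exact: ccont_on_cst|move=> x _; exact: is_cderive_cst].
Qed.

Lemma C1_on_cexp a b z :
  C1_on a b (fun t => cexp (z * t%:C)) (fun t => z * cexp (z * t%:C)).
Proof.
split; [exact: ccont_on_cexp| |by move=> x _; exact: is_cderive_cexp].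
by apply: ccont_onM; [exact: ccont_on_cst|exact: ccont_on_cexp].
Qed.

Lemma C1_FTC a b f df : a < b -> C1_on a b f df -> cint_itv a b df = f b - f a.
Proof.
move=> ab [[c1 c2] [d1 d2] fd].
have FTC (h dh : R -> R) : {within `[a, b], continuous h} ->
    {within `[a, b], continuous dh} ->
    (forall x, x \in `]a, b[ -> is_derive x 1 h (dh x)) ->
    \int[lebesgue_measure]_(x in `[a, b]) dh x = h b - h a.
  move=> hc dhc hd; rewrite /Rintegral (@continuous_FTC2 _ _ h)//.
    have /(continuous_within_itvP _ ab)[_ la lb] := hc; split => // x xab.
    by have [] := hd _ xab.
  by move=> x xab; rewrite derive1E; have := hd _ xab => /@derive_val.
apply: complex_eq => /=; rewrite !ReIm.
  by apply: (FTC (fun t => Re (f t))) => // x /fd[].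
by apply: (FTC (fun t => Im (f t))) => // x /fd[].
Qed.

Lemma C1_lipschitz a b f df : C1_on a b f df ->
  exists2 K, 0 <= K & forall s t, s \in `]a, b[ -> t \in `]a, b[ -> s <= t ->
    normc (f t - f s) <= K * (t - s).
Proof.
move=> [_ [/within_bounded[K K0 dK] /within_bounded[L L0 dL]] fd].
exists (K + L) => [|s t]; first exact: addr_ge0.
rewrite !in_itv/= => /andP[as_ sb] /andP[at_ tb] st.
have lip (h dh : R -> R) M : (forall x, x \in `]a, b[ -> is_derive x 1 h (dh x)) ->
    (forall x, x \in `[a, b] -> `|dh x| <= M) -> `|h t - h s| <= M * (t - s).
  move=> hd hM.
  have sub x : x \in `[s, t] -> x \in `]a, b[.
    rewrite !in_itv/= => /andP[sx xt].
    by rewrite (lt_le_trans as_ sx) (le_lt_trans xt tb).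
  have hd' x : x \in `]s, t[ -> is_derive x 1 h (dh x).
    by move=> xst; apply: hd; apply: sub; exact: subset_itv_oo_cc.
  have hc : {within `[s, t], continuous h}.
    apply: derivable_within_continuous => x xst.
    by have [] := hd x (sub x xst).
  have [x xst ->] := MVT_segment st hd' hc.
  rewrite normrM (ger0_norm (_ : 0 <= t - s)) ?subr_ge0// ler_wpM2r ?subr_ge0//.
  by apply: hM; apply: subset_itv_oo_cc; exact: sub.
rewrite (le_trans (normc_le_ReIm _))// mulrDl lerD// !ReIm.
  by apply: (lip (fun t => Re (f t)) (fun t => Re (df t))) => // x /fd[].
by apply: (lip (fun t => Im (f t)) (fun t => Im (df t))) => // x /fd[].
Qed.

Lemma cint_itv_continuous a b f : a <= b -> cint_able a b f ->
  ccont_on a b (fun t => cint_itv a t f).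
Proof. by move=> ab [f1 f2]; split; exact: parameterized_integral_continuous. Qed.

Lemma C1_cint_itv a b f : a < b -> ccont_on a b f ->
  C1_on a b (fun t => cint_itv a t f) f.
Proof.
move=> ab fc; have [f1 f2] := ccont_on_integrable fc.
split => //; first by apply: cint_itv_continuous; rewrite ?ltW//; exact: ccont_on_integrable.
case: fc => c1 c2 x xab; have := xab; rewrite in_itv/= => /andP[ax xb].
have FTC (h : R -> R) : {within `[a, b], continuous h} ->
    lebesgue_measure.-integrable `[a, b] (EFin \o h) ->
    is_derive x 1 (fun t => \int[lebesgue_measure]_(y in `[a, t]) h y) (h x).
  move=> hc hi.
  have [dh he] := continuous_FTC1_closed xb hi ax (within_continuous_continuous ab hc xab).
  by rewrite -he derive1E; apply: DeriveDef.
by split; exact: FTC.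
Qed.

End ComplexCalculus.

(** * Piecewise functions on the intervals *)

Section Pieces.
Context (R : realType) (n : nat).
Variables alpha beta : 'I_n -> R.
Hypothesis lt_alpha_beta : forall i, alpha i < beta i.
Hypothesis lt_beta_alpha : forall i j : 'I_n, (i < j)%N -> beta i < alpha j.
Implicit Types (g h : 'I_n -> R -> R[i]) (f : R -> R[i]) (i : 'I_n).
Local Notation J := (J alpha beta).
Local Notation Omega := (Omega alpha beta).
Local Notation mu := (mu_Omega alpha beta).
Local Notation leb := (@lebesgue_measure R).

Lemma J_inj i j t : J i t -> J j t -> i = j.
Proof.
wlog ij : i j / (i < j)%N.
  move=> wl it jt; case: (ltngtP i j) => [|ji|/val_inj//]; first by move/wl; apply.
  by apply/esym/wl.
rewrite /J/= !in_itv/= => /andP[_ tb] /andP[at_ _].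
by have := lt_trans (lt_trans tb (lt_beta_alpha ij)) at_; rewrite ltxx.
Qed.

Lemma trivIset_J (D : set 'I_n) : trivIset D J.
Proof. by apply/trivIsetP => i j _ _ /eqP ij; apply/seteqP; split=> // t [] /J_inj h /h. Qed.

Lemma alpha_notin i : ~ Omega (alpha i).
Proof.
move=> [j _]; rewrite /J/= in_itv/= => /andP[ai ib].
case: (ltngtP i j) => [ij|ji|/val_inj ij].
- by have := lt_trans (lt_trans (lt_alpha_beta i) (lt_beta_alpha ij)) ai; rewrite ltxx.
- by have := lt_trans ib (lt_beta_alpha ji); rewrite ltxx.
- by rewrite ij ltxx in ai.
Qed.

Lemma beta_notin i : ~ Omega (beta i).
Proof.
move=> [j _]; rewrite /J/= in_itv/= => /andP[ai ib].
case: (ltngtP i j) => [ij|ji|/val_inj ij].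
- by have := lt_trans (lt_beta_alpha ij) ai; rewrite ltxx.
- by have := lt_trans (lt_trans (lt_alpha_beta i) ib) (lt_beta_alpha ji); rewrite ltxx.
- by rewrite ij ltxx in ib.
Qed.

(** With one function per interval, every [g i] can be continuous up to the endpoints of its own
    interval, although the assembled function is zero there. *)
Definition pw g : R -> R[i] := fun t => \sum_i (\1_(J i) t)%:C * g i t.

Lemma pwE g i t : J i t -> pw g t = g i t.
Proof.
move=> it; rewrite /pw (bigD1 i)//= indicE mem_set// mul1r big1 ?addr0// => j ji.
rewrite indicE memNset ?mul0r// => jt.
by move/eqP: ji; apply; exact: J_inj jt it.
Qed.

Lemma pw_out g t : ~ Omega t -> pw g t = 0.
Proof.
move=> Ot; rewrite /pw big1// => i _; rewrite indicE memNset ?mul0r// => it.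
by apply: Ot; exists i.
Qed.

Lemma pw_op (op : R[i] -> R[i] -> R[i]) g h : op 0 0 = 0 ->
  pw (fun i t => op (g i t) (h i t)) = fun t => op (pw g t) (pw h t).
Proof.
move=> op0; apply/funext => t; have [[i _ it]|Ot] := pselect (Omega t).
  by rewrite !(pwE _ it).
by rewrite !pw_out.
Qed.

Lemma pw_op1 (op : R[i] -> R[i]) g : op 0 = 0 ->
  pw (fun i t => op (g i t)) = fun t => op (pw g t).
Proof. by move=> op0; rewrite (@pw_op (fun z _ => op z) g g). Qed.

Lemma Re_pw g t : Re (pw g t) = \sum_i ((fun s => Re (g i s)) \_ (J i)) t.
Proof.
rewrite /pw Re_sum; apply: eq_bigr => i _; rewrite ReM/= mul0r subr0 indicE patchE.
by case: ifP; rewrite ?mul1r ?mul0r.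
Qed.

Lemma Im_pw g t : Im (pw g t) = \sum_i ((fun s => Im (g i s)) \_ (J i)) t.
Proof.
rewrite /pw Im_sum; apply: eq_bigr => i _; rewrite ImM/= mul0r addr0 indicE patchE.
by case: ifP; rewrite ?mul1r ?mul0r.
Qed.

Definition pieces_cont g := forall i, ccont_on (alpha i) (beta i) (g i).

Definition pieces_C1 g dg := forall i, C1_on (alpha i) (beta i) (g i) (dg i).

Lemma measurable_pw g : pieces_cont g ->
  measurable_fun setT (fun t => Re (pw g t)) /\
  measurable_fun setT (fun t => Im (pw g t)).
Proof.
have m (k : 'I_n -> R -> R) :
    (forall i, {within `[alpha i, beta i], continuous (k i)}) ->
    measurable_fun setT (fun t => \sum_i (k i \_ (J i)) t).
  move=> kc; apply: measurable_sum => i.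
  apply/(measurable_restrictT _ _).1; first exact: measurable_itv.
  apply: (@measurable_funS _ _ _ _ `[alpha i, beta i]%classic) => //.
    exact: subset_itv_oo_cc.
  by apply: subspace_continuous_measurable_fun; [exact: measurable_itv|exact: kc].
move=> gc; split.
  under eq_fun do rewrite Re_pw; apply: m => i; exact: (gc i).1.
under eq_fun do rewrite Im_pw; apply: m => i; exact: (gc i).2.
Qed.

Lemma pw_bounded g : pieces_cont g -> exists2 K, 0 <= K & forall t, normc (pw g t) <= K.
Proof.
move=> gc.
have [K hK] : {K : 'I_n -> R & forall i, 0 <= K i /\
    forall t, t \in `[alpha i, beta i] -> normc (g i t) <= K i}.
  apply: (@choice _ _ (fun i K => 0 <= K /\
    forall t, t \in `[alpha i, beta i] -> normc (g i t) <= K)) => i.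
  by have [K K0 hK] := ccont_on_bounded (gc i); exists K.
exists (\sum_i K i); first by apply: sumr_ge0 => i _; have [] := hK i.
move=> t; have [[i _ it]|Ot] := pselect (Omega t).
  rewrite (pwE _ it) (bigD1 i)//= (le_trans ((hK i).2 t _))//.
    exact: subset_itv_oo_cc.
  by rewrite lerDl sumr_ge0// => j _; have [] := hK j.
by rewrite pw_out// normc0; apply: sumr_ge0 => i _; have [] := hK i.
Qed.

Lemma Omega_bounded : exists2 T, 0 < T & forall i, `|alpha i| <= T /\ `|beta i| <= T.
Proof.
exists (1 + \sum_i (`|alpha i| + `|beta i|)).
  by rewrite ltr_pwDl// sumr_ge0// => i _; rewrite addr_ge0.
move=> i; rewrite (bigD1 i)//=; set X := \sum_(_ | _) _.
have X0 : 0 <= X by apply: sumr_ge0 => j _; rewrite addr_ge0.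
by have := normr_ge0 (alpha i); have := normr_ge0 (beta i); split; lra.
Qed.

Lemma mu_Omega_finite : (mu setT < +oo)%E.
Proof.
have [T T0 hT] := Omega_bounded.
rewrite /mu_Omega /mrestr setTI.
apply: (@le_lt_trans _ _ (leb `[- T, T]%classic)).
  apply: le_measure; rewrite ?inE//; first exact: measurable_Omega.
  move=> t [i _]; rewrite /J/= !in_itv/= => /andP[at_ tb].
  have [/ler_normlP[a1 a2] /ler_normlP[b1 b2]] := hT i.
  by apply/andP; split; lra.
by rewrite lebesgue_measure_itv/=; case: ifP; rewrite ?ltry// -EFinB ltry.
Qed.

Lemma ae_Omega (Q : R -> Prop) : (forall t, Omega t -> Q t) -> {ae mu, forall t, Q t}.
Proof.
move=> OQ; exists (~` Omega); split.
- by apply: measurableC; exact: measurable_Omega.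
- by rewrite /mu_Omega /mrestr setICl measure0.
- by move=> t /= nQ Ot; apply: nQ; exact: OQ.
Qed.

(** The complement of [Omega] is null for [mu], and on measurable subsets of [Omega] the two
    measures agree. The negligible set is removed from the positive and the negative part
    separately. *)
Lemma integral_Omega (h : R -> R) : measurable_fun setT h ->
  (\int[mu]_t (h t)%:E = \int[leb]_(t in Omega) (h t)%:E)%E.
Proof.
move=> mh; have mO := measurable_Omega alpha beta.
have mC : measurable (~` Omega : set (measurableTypeR R)) by exact: measurableC.
have muC : mu (~` Omega) = 0%E by rewrite /mu_Omega /mrestr setICl measure0.
have nn (k : R -> \bar R) : measurable_fun setT k -> (forall t, (0 <= k t)%E) ->
    (\int[mu]_t k t = \int[mu]_(t in Omega) k t)%E.
  move=> mk k0; rewrite (@ge0_negligible_integral _ _ _ mu _ (~` Omega))//.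
  by rewrite setTD setCK.
have -> : (\int[mu]_t (h t)%:E = \int[mu]_(t in Omega) (h t)%:E)%E.
  have mhE : measurable_fun setT (EFin \o h) by exact/measurable_EFinP.
  rewrite integralE [RHS]integralE; congr (_ - _)%E; apply: nn => //.
  - exact: measurable_funepos.
  - exact: measurable_funeneg.
apply: eq_measure_integral => D mD DO.
by transitivity (leb (D `&` Omega)); rewrite // setIidl.
Qed.

Lemma integrable_Omega (h : R -> R) : measurable_fun setT h ->
  mu.-integrable setT (EFin \o h) <-> leb.-integrable Omega (EFin \o h).
Proof.
move=> mh; have mn : measurable_fun setT (fun t => `|h t|) by exact: measurableT_comp.
have E := integral_Omega mn.
split=> /integrableP[_ i]; apply/integrableP; split; try (apply: measurable_funTS);
  try exact/measurable_EFinP.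
  by move: i; rewrite -[X in (X < _)%E -> _]/(\int[mu]_t `|h t|%:E)%E E.
by rewrite -[X in (X < _)%E]/(\int[mu]_t `|h t|%:E)%E E.
Qed.

(** Endpoints are negligible, so every piece is integrated over the closed interval, as [C1_FTC]
    requires. *)
Lemma cint_pw g : pieces_cont g ->
  cint mu (pw g) = \sum_i cint_itv (alpha i) (beta i) (g i).
Proof.
move=> gc; have [m1 m2] := measurable_pw gc.
have OE : Omega = \big[setU/set0]_(i <- enum 'I_n) J i.
  rewrite -bigcup_seq; apply: eq_bigcupl.
  by split => i //= _; rewrite mem_enum.
have S (h : R -> R) (k : 'I_n -> R -> R) : measurable_fun setT h ->
    (forall i, {within `[alpha i, beta i], continuous (k i)}) ->
    (forall i t, J i t -> h t = k i t) ->
    \int[mu]_t h t = \sum_i \int[leb]_(t in `[alpha i, beta i]) k i t.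
  move=> mh kc hk; rewrite /Rintegral integral_Omega// OE.
  have mJ i : measurable (J i : set (measurableTypeR R)) by exact: measurable_itv.
  have mhE : measurable_fun (\big[setU/set0]_(i <- enum 'I_n) J i) (EFin \o h).
    by apply: measurable_funTS; exact/measurable_EFinP.
  rewrite (integral_bigsetU_EFin leb mJ (enum_uniq _) (@trivIset_J _) mhE).
  have iE i : (\int[leb]_(t in J i) (h t)%:E = \int[leb]_(t in `[alpha i, beta i]) (k i t)%:E)%E.
    rewrite [RHS]integral_itv_bndoo; last first.
      apply/measurable_EFinP.
      apply: (@measurable_funS _ _ _ _ `[alpha i, beta i]%classic) => //.
        exact: subset_itv_oo_cc.
      by apply: subspace_continuous_measurable_fun; [exact: measurable_itv|exact: kc].
    by apply: eq_integral => t /set_mem /hk ->.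
  under eq_bigr do rewrite iE.
  have kfin i : (\int[leb]_(t in `[alpha i, beta i]) (k i t)%:E)%E \is a fin_num.
    apply: integrable_fin_num; first exact: measurable_itv.
    by apply: continuous_compact_integrable; [exact: segment_compact|exact: kc].
  rewrite big_enum/= (eq_bigr (fun i => (fine (\int[leb]_(t in `[alpha i, beta i])
    (k i t)%:E))%:E)); first by rewrite sumEFin.
  by move=> i _; rewrite fineK.
apply: complex_eq; rewrite ?Re_sum ?Im_sum/=.
  apply: (S _ (fun i t => Re (g i t))) => // [i|i t it]; first exact: (gc i).1.
  by rewrite (pwE _ it).
apply: (S _ (fun i t => Im (g i t))) => // [i|i t it]; first exact: (gc i).2.
by rewrite (pwE _ it).
Qed.

Lemma L2pred_bounded f K : measurable_fun setT (fun t => Re (f t)) ->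
  measurable_fun setT (fun t => Im (f t)) -> (forall t, normc (f t) <= K) ->
  f \in L2pred mu.
Proof.
have m (h : R -> R) : measurable_fun setT h -> (forall t, `|h t| <= K) ->
    h \in Lfun mu 2%:E.
  move=> mh hK; apply: Lfun2P => //.
  apply: (@le_lt_trans _ _ (\int[mu]_t (cst (K ^+ 2)%:E) t)%E).
    apply: ge0_le_integral => //.
    - by move=> t _; rewrite lee_fin sqr_ge0.
    - by apply/measurable_EFinP; exact: measurable_funX.
    - move=> t _; rewrite lee_fin -(real_normK (num_real (h t))).
      by rewrite ler_pXn2r ?nnegrE// (le_trans _ (hK t)).
  rewrite integral_cst//= lte_mul_pinfty ?lee_fin ?sqr_ge0//.
  exact: mu_Omega_finite.
move=> m1 m2 fK; apply/andP; split; apply: m => // t.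
  exact: le_trans (Re_le_normc _) (fK t).
exact: le_trans (Im_le_normc _) (fK t).
Qed.

Lemma L2pred_pw g : pieces_cont g -> pw g \in L2pred mu.
Proof.
move=> gc; have [m1 m2] := measurable_pw gc; have [K _ gK] := pw_bounded gc.
exact: L2pred_bounded gK.
Qed.

Lemma hnorm_bounded (u : L2 mu) f K : 0 <= K -> f \in L2pred mu -> is_class_of u f ->
  (forall t, normc (f t) <= K) ->
  hnorm L2ip u <= K * Num.sqrt (fine (mu setT)).
Proof.
move=> K0 fL uf fK; have hip := @L2ip_inner_product _ _ _ mu.
rewrite -(@ler_pXn2r _ 2)// ?nnegrE ?hnorm_ge0 ?mulr_ge0//.
have mfin : mu setT \is a fin_num by rewrite ge0_fin_numE// mu_Omega_finite.
have -> : hnorm L2ip u ^+ 2 = Re (L2ip u u) := sqr_hnorm hip u.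
rewrite exprMn sqr_sqrtr ?fine_ge0//.
rewrite (@L2ip_class _ (measurableTypeR R) R mu u u f f fL fL uf uf).
rewrite /cint/=.
have [i1 _] := @L2pred_mul _ (measurableTypeR R) R mu f f fL fL.
rewrite -(Rintegral_cst mu measurableT); apply: le_Rintegral => //.
  apply/integrableP; split; first exact: measurable_cst.
  rewrite /= integral_cst//= lte_mul_pinfty// ?lee_fin//.
  exact: mu_Omega_finite.
move=> t _; rewrite !ReIm mulrN opprK -!expr2 -normc_def2.
by rewrite ler_pXn2r ?nnegrE ?normc_ge0.
Qed.

Lemma cintegrable_piece f i : cintegrable mu f -> cint_able (alpha i) (beta i) f.
Proof.
have s (h : R -> R) : mu.-integrable setT (EFin \o h) ->
    leb.-integrable `[alpha i, beta i] (EFin \o h).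
  move=> ih; have mh : measurable_fun setT h.
    by apply/measurable_EFinP; exact: (measurable_int mu).
  have /integrableP[_ iJ] : leb.-integrable (J i) (EFin \o h).
    have mO : measurable (Omega : set (measurableTypeR R)) := measurable_Omega _ _.
    have mJ : measurable (J i : set (measurableTypeR R)) by exact: measurable_itv.
    have JO : J i `<=` Omega by move=> t it; exists i.
    exact: (integrableS mO mJ JO ((integrable_Omega mh).1 ih)).
  apply/integrableP; split; first by apply: measurable_funTS; exact/measurable_EFinP.
  rewrite integral_itv_bndoo//; apply: measurable_funTS.
  by apply: measurableT_comp => //; exact/measurable_EFinP.
by move=> [f1 f2]; split; exact: s.
Qed.

Lemma cint_indic f i t : measurable_fun setT (fun t => Re (f t)) ->
  measurable_fun setT (fun t => Im (f t)) -> t <= beta i ->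
  cint mu (fun s => (\1_(`]alpha i, t[) s)%:C * f s) = cint_itv (alpha i) t f.
Proof.
move=> m1 m2 tb.
have s (h : R -> R) : measurable_fun setT h ->
    \int[mu]_s (h \_ `]alpha i, t[) s = \int[leb]_(s in `[alpha i, t]) h s.
  move=> mh; rewrite /Rintegral integral_Omega; last first.
    apply/(measurable_restrictT _ _).1; first exact: measurable_itv.
    exact: measurable_funTS.
  have -> : (\int[leb]_(s in Omega) ((h \_ `]alpha i, t[) s)%:E =
      \int[leb]_(s in Omega) ((EFin \o h) \_ `]alpha i, t[) s)%E.
    by apply: eq_integral => s _; rewrite !patchE; case: ifP.
  rewrite -integral_mkcondr setIidr; last first.
    move=> s; rewrite /= in_itv/= => /andP[as_ st]; exists i => //.
    by rewrite /J/= in_itv/= as_ (lt_le_trans st tb).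
  rewrite [in RHS]integral_itv_bndoo//; apply: measurable_funTS.
  exact/measurable_EFinP.
apply: complex_eq => /=; rewrite -s//; apply: eq_Rintegral => x _; rewrite ReIm/=.
  rewrite mul0r subr0 indicE patchE; by case: ifP; rewrite ?mul1r ?mul0r.
by rewrite mul0r addr0 indicE patchE; case: ifP; rewrite ?mul1r ?mul0r.
Qed.

End Pieces.

(** * The operator with boundary condition [B] *)

Section PieceOperator.
Context (R : realType) (n : nat).
Variables alpha beta : 'I_n -> R.
Hypothesis lt_alpha_beta : forall i, alpha i < beta i.
Hypothesis lt_beta_alpha : forall i j : 'I_n, (i < j)%N -> beta i < alpha j.
Variable B : 'M[R[i]]_n.
Implicit Types (g f dg : 'I_n -> R -> R[i]) (i : 'I_n) (u v w : L2Omega alpha beta).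
Local Notation J := (J alpha beta).
Local Notation Omega := (Omega alpha beta).
Local Notation mu := (mu_Omega alpha beta).
Local Notation pw := (pw alpha beta).
Local Notation pieces_C1 := (pieces_C1 alpha beta).
Local Notation pieces_cont := (pieces_cont alpha beta).
Local Notation hip := (@L2ip_inner_product _ (measurableTypeR R) R mu).

Lemma ip_pw (g f : 'I_n -> R -> R[i]) u v : pieces_cont g -> pieces_cont f ->
  is_class_of u (pw g) -> is_class_of v (pw f) ->
  L2ip u v = cint mu (fun t => pw g t * Num.conj (pw f t)).
Proof.
move=> gc fc ug vf.
have gL := L2pred_pw lt_beta_alpha gc.
have fL := L2pred_pw lt_beta_alpha fc.
by rewrite (@L2ip_class _ (measurableTypeR R) R mu u v (pw g) (pw f) gL fL ug vf).
Qed.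

Lemma pw_class g : pieces_cont g -> exists u : L2Omega alpha beta, is_class_of u (pw g).
Proof.
move=> /(L2pred_pw lt_beta_alpha) gL.
exact: (@is_class_of_exists _ (measurableTypeR R) R mu (pw g) gL).
Qed.

(** Integration by parts on every interval. The boundary terms vanish because a test function is
    zero off [Omega], hence at all endpoints; the sign is compensated by the conjugate of
    [twopii^-1]. *)
Lemma pieces_adjoint g dg u v : pieces_C1 g dg -> is_class_of u (pw g) ->
  is_class_of v (pw dg) -> adjoint L2ip (opD alpha beta) (u, twopii^-1 *: v).
Proof.
move=> gC ug vdg a b [phi [sphi [K [cK KO phi0]]] [aphi bphi]] /=.
have phi_out t : ~ Omega t -> phi t = 0 by move=> Ot; apply: phi0 => /KO.
have dphi x : is_cderive x phi (cderive phi x).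
  exact: cderivable_is_cderive (smooth_cderivable sphi x).1.
have ddphi x : is_cderive x (cderive phi) (cderive (cderive phi) x).
  exact: cderivable_is_cderive (smooth_cderivable sphi x).2.
have phiC : pieces_C1 (fun=> phi) (fun=> cderive phi).
  move=> i; split; [exact: ccont_on_derive dphi|exact: ccont_on_derive ddphi|].
  by move=> x _; exact: dphi.
have aP : is_class_of a (pw (fun=> phi)).
  apply: is_class_of_ext aphi => t; have [[i _ it]|Ot] := pselect (Omega t).
    by rewrite (pwE lt_beta_alpha _ it).
  by rewrite pw_out// phi_out.
have cdphi : pieces_cont (fun=> cderive phi) by move=> i; exact: (C1_dcont (phiC i)).
have cphi : pieces_cont (fun=> phi) by move=> i; exact: (C1_cont (phiC i)).
have cg : pieces_cont g by move=> i; exact: (C1_cont (gC i)).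
have cdg : pieces_cont dg by move=> i; exact: (C1_dcont (gC i)).
have [b0 b0P] := pw_class cdphi.
have -> : b = twopii^-1 *: b0.
  apply: is_class_of_uniq (is_class_of_scale twopii^-1 b0P).
  apply: is_class_of_eq bphi _; apply: ae_Omega => t [i _ it].
  by rewrite (pwE lt_beta_alpha _ it).
rewrite (ipZl hip) (ipZr hip) conj_twopiiV mulNr.
apply/eqP; rewrite -subr_eq0 opprK -mulrDr mulf_eq0; apply/orP; right; apply/eqP.
rewrite (ip_pw cdphi cg b0P ug) (ip_pw cphi cdg aP vdg).
have p := L2pred_pw lt_beta_alpha.
rewrite -[X in X + _]mul1r -cint_comb; last 2 first.
- exact: (@L2pred_mul _ (measurableTypeR R) R mu _ _ (p _ cdphi) (p _ cg)).
- exact: (@L2pred_mul _ (measurableTypeR R) R mu _ _ (p _ cphi) (p _ cdg)).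
have prodC i := C1_onM (phiC i) (C1_on_conj (gC i)).
have -> : (fun t => 1 * (pw (fun=> cderive phi) t * Num.conj (pw g t)) +
      pw (fun=> phi) t * Num.conj (pw dg t)) =
    pw (fun i t => cderive phi t * Num.conj (g i t) + phi t * Num.conj (dg i t)).
  apply/funext => t; rewrite mul1r; have [[i _ it]|Ot] := pselect (Omega t).
    by rewrite !(pwE lt_beta_alpha _ it).
  by rewrite !pw_out// !mul0r addr0.
rewrite cint_pw//; last by move=> i; exact: (C1_dcont (prodC i)).
rewrite big1// => i _; rewrite (C1_FTC (lt_alpha_beta i) (prodC i)).
rewrite (phi_out (alpha i)) ?(phi_out (beta i)) ?mul0r ?subrr//.
  exact: (beta_notin lt_alpha_beta lt_beta_alpha).
exact: (alpha_notin lt_alpha_beta lt_beta_alpha).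
Qed.

Let near_J i t : J i t -> \near t, J i t.
Proof. by move=> it; exact: near_in_itvoo. Qed.

Lemma pw_cderive g i t z : J i t -> is_cderive t (g i) z -> is_cderive t (pw g) z.
Proof.
move=> it [d1 d2]; split; [apply: near_eq_is_derive d1|apply: near_eq_is_derive d2];
  by near=> s; rewrite (pwE lt_beta_alpha _ (_ : J i s))//; near: s; exact: near_J.
Unshelve. all: by end_near. Qed.

Lemma pw_AC g dg i : pieces_C1 g dg -> absolutely_continuous (J i) (pw g).
Proof.
move=> gC e e0; have [K K0 gK] := C1_lipschitz (gC i).
have K1 : 0 < K + 1 by rewrite ltr_wpDl.
exists (e / (K + 1)); first exact: divr_gt0.
move=> m a b ab abJ _ sd.
apply: (@le_lt_trans _ _ (K * \sum_k (b k - a k))).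
  rewrite mulr_sumr; apply: ler_sum => k _.
  have ak : J i (a k) by apply: (abJ k); rewrite /= in_itv/= lexx ab.
  have bk : J i (b k) by apply: (abJ k); rewrite /= in_itv/= lexx ab.
  by rewrite (pwE lt_beta_alpha _ ak) (pwE lt_beta_alpha _ bk); exact: gK.
rewrite ltr_pdivlMr// in sd; apply: le_lt_trans sd.
rewrite mulrC ler_wpM2l ?lerDl//.
by apply: sumr_ge0 => k _; rewrite subr_ge0.
Qed.

Lemma pw_lim g i : pieces_cont g ->
  ccvg (pw g) (alpha i)^'+ (g i (alpha i)) /\ ccvg (pw g) (beta i)^'- (g i (beta i)).
Proof.
move=> gc; have ab := lt_alpha_beta i.
have r : \forall t \near (alpha i)^'+, J i t.
  near=> t; rewrite /J/= in_itv/=; apply/andP; split; near: t.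
    exact: nbhs_right_gt.
  exact: nbhs_right_lt.
have l : \forall t \near (beta i)^'-, J i t.
  near=> t; rewrite /J/= in_itv/=; apply/andP; split; near: t.
    exact: nbhs_left_gt.
  exact: nbhs_left_lt.
have L (h k : R -> R) : {within `[alpha i, beta i], continuous h} ->
    (forall t, J i t -> h t = k t) ->
    k t @[t --> (alpha i)^'+] --> h (alpha i) /\ k t @[t --> (beta i)^'-] --> h (beta i).
  move=> hc hk; have [_ ha hb] := (continuous_within_itvP _ ab).1 hc.
  split; [apply: cvg_trans ha|apply: cvg_trans hb]; apply: near_eq_cvg.
    by near=> t; rewrite hk//; near: t.
  by near=> t; rewrite hk//; near: t.
have [a1 b1] := L (fun t => Re (g i t)) (fun t => Re (pw g t)) (gc i).1
  (fun t it => congr1 (@Re R) (esym (pwE lt_beta_alpha g it))).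
have [a2 b2] := L (fun t => Im (g i t)) (fun t => Im (pw g t)) (gc i).2
  (fun t it => congr1 (@Im R) (esym (pwE lt_beta_alpha g it))).
by [].
Unshelve. all: by end_near. Qed.

Lemma pieces_dom_B g dg u : pieces_C1 g dg -> is_class_of u (pw g) ->
  B *m (\col_i g i (alpha i)) = \col_i g i (beta i) -> dom_B B u.
Proof.
move=> gC ug bE.
have cg : pieces_cont g by move=> i; exact: (C1_cont (gC i)).
have cdg : pieces_cont dg by move=> i; exact: (C1_dcont (gC i)).
have dE i t : J i t -> is_cderive t (pw g) (dg i t).
  by move=> it; apply: (pw_cderive it); exact: (C1_derive (gC i)).
exists (pw g); split; last first.
  exists (\col_i g i (alpha i)), (\col_i g i (beta i)).
  by split=> // i; rewrite mxE; have [] := pw_lim i cg.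
split => //.
- by move=> i; exact: pw_AC gC.
- by apply: ae_Omega => t [i _ /dE[d1 d2]]; split; [case: d1|case: d2].
- have [v vdg] := pw_class cdg.
  exists v; apply: is_class_of_eq vdg _; apply: ae_Omega => t [i _ it].
  rewrite (pwE lt_beta_alpha _ it); have [d1 d2] := dE i t it.
  by apply: complex_eq; rewrite /= derive1E; apply/esym/derive_val.
Qed.

(** Absolute continuity is applied to a single interval, the one between [t] and a nearby point. *)
Lemma AC_continuous (f : R -> R[i]) i t : absolutely_continuous (J i) f -> J i t ->
  {for t, continuous (fun s => Re (f s))} /\ {for t, continuous (fun s => Im (f s))}.
Proof.
move=> fAC it.
have close e : 0 < e -> \forall s \near t, normc (f t - f s) < e.
  move=> e0; have [d d0 fd] := fAC e e0.
  have step a b : a <= b -> J i a -> J i b -> b - a < d -> normc (f b - f a) < e.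
    move=> ab ia ib bad.
    have := fd 1%N (fun=> a) (fun=> b); rewrite !big_ord1; apply => //.
      move=> _ s; rewrite /= in_itv/= => /andP[as_ sb]; move: ia ib.
      rewrite /J/= !in_itv/= => /andP[aa _] /andP[_ bb].
      by rewrite (lt_le_trans aa as_) (le_lt_trans sb bb).
    by apply/trivIsetP => j k _ _; rewrite (ord1 j) (ord1 k) eqxx.
  near=> s.
  have is_ : J i s by near: s; exact: near_J.
  have sd : `|t - s| < d by near: s; exact: cvgr_dist_lt.
  have [ts|st] := leP t s.
    have -> : f t - f s = - (f s - f t) by rewrite opprB.
    rewrite normcN; apply: step => //.
    by apply: le_lt_trans sd; rewrite distrC ler_norm.
  by apply: step => //; [exact: ltW|apply: le_lt_trans sd; exact: ler_norm].
split; apply/cvgrPdist_lt => e /close; apply: filterS => s; apply: le_lt_trans.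
  by rewrite -ReN -ReD Re_le_normc.
by rewrite -ImN -ImD Im_le_normc.
Unshelve. all: by end_near. Qed.

(** The representative is given its one-sided limits as values at the endpoints. Continuity on the
    closed intervals is what makes the Duhamel solution with this right-hand side [C^1]. *)
Lemma dom_B_pieces u : dom_B B u ->
  exists2 g, pieces_cont g & is_class_of u (pw g).
Proof.
move=> [f [[uf fAC _ _] [fa [fb [fa_lim fb_lim _]]]]].
pose g i t := if t == alpha i then fa i 0 else if t == beta i then fb i 0 else f t.
have gJ i t : J i t -> g i t = f t.
  rewrite /g /J/= in_itv/= => /andP[at_ tb].
  by rewrite gt_eqF// lt_eqF.
have ga i : g i (alpha i) = fa i 0 by rewrite /g eqxx.
have gb i : g i (beta i) = fb i 0.
  by rewrite /g gt_eqF// eqxx.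
exists g; last first.
  apply: is_class_of_eq uf _; apply: ae_Omega => t [i _ it].
  by rewrite (pwE lt_beta_alpha _ it) gJ.
move=> i; have ab := lt_alpha_beta i.
have r : \forall t \near (alpha i)^'+, f t = g i t.
  near=> t; rewrite gJ// /J/= in_itv/=; apply/andP; split; near: t.
    exact: nbhs_right_gt.
  exact: nbhs_right_lt.
have l : \forall t \near (beta i)^'-, f t = g i t.
  near=> t; rewrite gJ// /J/= in_itv/=; apply/andP; split; near: t.
    exact: nbhs_left_gt.
  exact: nbhs_left_lt.
have [fa1 fa2] := fa_lim i; have [fb1 fb2] := fb_lim i.
split; apply/(continuous_within_itvP _ ab); split => /=.
- move=> t it; have [c1 _] := AC_continuous (fAC i) it.
  rewrite /prop_for /continuous_at gJ//.
  apply: cvg_trans c1; apply: near_eq_cvg.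
  by near=> s; rewrite gJ//; near: s; exact: near_J.
- by rewrite ga; apply: cvg_trans fa1; apply: near_eq_cvg; apply: filterS r => t ->.
- by rewrite gb; apply: cvg_trans fb1; apply: near_eq_cvg; apply: filterS l => t ->.
- move=> t it; have [_ c2] := AC_continuous (fAC i) it.
  rewrite /prop_for /continuous_at gJ//.
  apply: cvg_trans c2; apply: near_eq_cvg.
  by near=> s; rewrite gJ//; near: s; exact: near_J.
- by rewrite ga; apply: cvg_trans fa2; apply: near_eq_cvg; apply: filterS r => t ->.
- by rewrite gb; apply: cvg_trans fb2; apply: near_eq_cvg; apply: filterS l => t ->.
Unshelve. all: by end_near. Qed.

Local Notation A := (restriction (adjoint L2ip (opD alpha beta)) (dom_B B)).

Lemma pieces_graph g dg u v : pieces_C1 g dg -> is_class_of u (pw g) ->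
  is_class_of v (pw dg) -> B *m (\col_i g i (alpha i)) = \col_i g i (beta i) ->
  A (u, twopii^-1 *: v).
Proof.
move=> gC ug vdg bE; split => /=; first exact: pieces_adjoint vdg.
exact: pieces_dom_B bE.
Qed.

Definition duhamel (l : R[i]) (i : 'I_n) (t : R) (h : R -> R[i]) : R[i] :=
  twopii * cint_itv (alpha i) t (fun s => cexp (- (twopii * l) * s%:C) * h s).

Definition green (l : R[i]) (c : 'cV[R[i]]_n) (h : 'I_n -> R -> R[i]) i t : R[i] :=
  cexp (twopii * l * t%:C) * (c i 0 + duhamel l i t (h i)).

Lemma cint_itv_xx a (h : R -> R[i]) : cint_itv a a h = 0.
Proof. by apply: complex_eq => /=; rewrite set_itv1 Rintegral_set1. Qed.

(** By the product rule the pieces have derivative [dg = 2 pi i (l u + f)]. The Duhamel term is zero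
    at [alpha i] and [k i] at [beta i], so the equation for [c] is exactly the boundary
    condition. *)
Lemma green_graph l (c k : 'cV[R[i]]_n) f u w : pieces_cont f -> is_class_of w (pw f) ->
  (forall i, k i 0 = duhamel l i (beta i) (f i)) ->
  B *m exp_col l alpha c = exp_col l beta (c + k) ->
  is_class_of u (pw (green l c f)) -> A (u, w + l *: u).
Proof.
move=> fc wf kE bE ug.
set z := twopii * l.
pose dg i t := z * green l c f i t + twopii * f i t.
have gC : pieces_C1 (green l c f) dg.
  move=> i; have iC : C1_on (alpha i) (beta i)
      (fun t => cint_itv (alpha i) t (fun s => cexp (- z * s%:C) * f i s))
      (fun t => cexp (- z * t%:C) * f i t).
    apply: C1_cint_itv => //; apply: ccont_onM => //; exact: ccont_on_cexp.
  have := C1_onM (C1_on_cexp (alpha i) (beta i) z)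
    (C1_onD (C1_on_cst (alpha i) (beta i) (c i 0))
      (C1_onM (C1_on_cst (alpha i) (beta i) twopii) iC)).
  congr (C1_on _ _ _); apply/funext => t.
  have ee : cexp (z * t%:C) * cexp (- z * t%:C) = 1 by rewrite mulNr cexpKN.
  rewrite /dg /green /duhamel -/z; set D := cint_itv _ _ _.
  transitivity (z * (cexp (z * t%:C) * (c i 0 + twopii * D)) +
    cexp (z * t%:C) * cexp (- z * t%:C) * (twopii * f i t)); first by ring.
  by rewrite ee mul1r.
have [v vdg] : exists v, is_class_of v (pw dg).
  by apply: pw_class => i; exact: (C1_dcont (gC i)).
have -> : w + l *: u = twopii^-1 *: v.
  have -> : v = twopii *: (w + l *: u).
    apply: is_class_of_uniq vdg _.
    have := is_class_of_scale twopii (is_class_of_comb l ug wf).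
    rewrite [l *: u + w]addrC; apply: is_class_of_ext => t.
    have [[i _ it]|Ot] := pselect (Omega t).
      by rewrite !(pwE lt_beta_alpha _ it) /dg mulrDr mulrA.
    by rewrite !pw_out// mulr0 addr0 mulr0.
  by rewrite scalerA mulVf ?twopii_neq0// scale1r.
apply: (pieces_graph gC ug vdg).
have -> : \col_i green l c f i (alpha i) = exp_col l alpha c.
  by apply/colP => i; rewrite !mxE /green /duhamel cint_itv_xx mulr0 addr0.
by rewrite bE; apply/colP => i; rewrite !mxE kE.
Qed.

Lemma exp_sumE l c : exp_sum alpha beta l c =
  pw (fun i t => cexp (twopii * l * t%:C) * c i 0).
Proof.
apply/funext => t; apply: eq_bigr => i _.
by ring.
Qed.

Lemma exp_sum_cont l (c : 'cV[R[i]]_n) : pieces_cont (fun i t => cexp (twopii * l * t%:C) * c i 0).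
Proof. by move=> i; apply: ccont_onM; [exact: ccont_on_cexp|exact: ccont_on_cst]. Qed.

Lemma exp_sum_graph l c u : B *m exp_col l alpha c = exp_col l beta c ->
  is_class_of u (exp_sum alpha beta l c) -> A (u, l *: u).
Proof.
rewrite exp_sumE => bE ug.
pose g i t := cexp (twopii * l * t%:C) * c i 0.
have gC : pieces_C1 g (fun i t => twopii * l * g i t).
  move=> i; have := C1_onM (C1_on_cexp (alpha i) (beta i) (twopii * l))
    (C1_on_cst (alpha i) (beta i) (c i 0)).
  by congr (C1_on _ _ _); apply/funext => t; rewrite /g; ring.
have vP : is_class_of ((twopii * l) *: u) (pw (fun i t => twopii * l * g i t)).
  have := is_class_of_scale (twopii * l) ug; apply: is_class_of_ext => t.
  by rewrite (@pw_op1 _ _ _ _ lt_beta_alpha (fun y => twopii * l * y)) ?mulr0.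
have := pieces_graph gC ug vP; rewrite scalerA mulrA mulVf ?twopii_neq0// mul1r.
apply.
have -> : \col_i g i (alpha i) = exp_col l alpha c by apply/colP => i; rewrite !mxE.
by rewrite bE; apply/colP => i; rewrite !mxE.
Qed.

End PieceOperator.

(** * Eigenspaces and exponential sums *)

Section Eigenspaces.
Context (R : realType) (n : nat).
Variables alpha beta : 'I_n -> R.
Hypothesis lt_alpha_beta : forall i, alpha i < beta i.
Hypothesis lt_beta_alpha : forall i j : 'I_n, (i < j)%N -> beta i < alpha j.
Variable B : 'M[R[i]]_n.
Hypothesis uB : B \is unitarymx.
Implicit Types (f : 'I_n -> R -> R[i]) (i : 'I_n) (u v w x : L2Omega alpha beta).
Implicit Types (c : 'cV[R[i]]_n).
Local Notation mu := (mu_Omega alpha beta).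
Local Notation pw := (pw alpha beta).
Local Notation pieces_cont := (pieces_cont alpha beta).
Local Notation hip := (@L2ip_inner_product _ (measurableTypeR R) R mu).
Local Notation A := (restriction (adjoint L2ip (opD alpha beta)) (dom_B B)).
Local Notation M := (Mlambda alpha beta B).
Local Notation duhamel := (duhamel alpha).
Local Notation green := (green alpha).

Lemma cint_itvZ (a b : R) (z : R[i]) h : cint_able a b h ->
  cint_itv a b (fun t => z * h t) = z * cint_itv a b h.
Proof.
move=> [h1 h2].
have Z (r : R) k : lebesgue_measure.-integrable `[a, b] (EFin \o k) ->
    lebesgue_measure.-integrable `[a, b] (EFin \o (fun t => r * k t)).
  move=> ki; have mab : measurable (`[a, b]%classic : set (measurableTypeR R)).
    exact: measurable_itv.
  by have := integrableZl mab r ki; apply: eq_integrable.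
apply: complex_eq; rewrite !ReIm/=.
  under eq_Rintegral do rewrite ReM.
  by rewrite RintegralB ?RintegralZl//; exact: Z.
under eq_Rintegral do rewrite ImM.
by rewrite RintegralD ?RintegralZl//; exact: Z.
Qed.

(** For real [t] the conjugate of the exponential is the factor in the Duhamel integral.
    Orthogonality to exponential sums thus becomes orthogonality of the vector of Duhamel integrals
    to [c], as in [Mlambda_fredholm]. *)
Lemma ip_exp_sum (t : R) c f x u : pieces_cont f -> is_class_of x (pw f) ->
  is_class_of u (exp_sum alpha beta t%:C c) ->
  twopii * L2ip x u = \sum_i duhamel t%:C i (beta i) (f i) * Num.conj (c i 0).
Proof.
move=> fc xf; rewrite exp_sumE => uc.
have gc := exp_sum_cont alpha beta t%:C c.
rewrite (ip_pw lt_beta_alpha fc gc xf uc).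
set g := fun i (s : R) => _ in gc *.
have -> : (fun s => pw f s * Num.conj (pw g s)) = pw (fun i s => f i s * Num.conj (g i s)).
  by rewrite (@pw_op _ _ _ _ lt_beta_alpha (fun y z => y * Num.conj z)) ?mul0r.
rewrite cint_pw//; last by move=> i; apply: ccont_onM => //; exact: ccont_on_conj.
rewrite mulr_sumr; apply: eq_bigr => i _.
rewrite -[RHS]mulrA; congr (twopii * _).
have ci : ccont_on (alpha i) (beta i) (fun s => cexp (- (twopii * t%:C) * s%:C) * f i s).
  by apply: ccont_onM => //; exact: ccont_on_cexp.
rewrite [RHS]mulrC -(cint_itvZ _ (ccont_on_integrable ci)); congr cint_itv.
apply/funext => s; rewrite /g conjM conj_phase conj_real mulNr.
by ring.
Qed.

Lemma green_cont l c h :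
  (forall i, cint_able (alpha i) (beta i) (fun s => cexp (- (twopii * l) * s%:C) * h i s)) ->
  pieces_cont (green l c h).
Proof.
move=> hi i; apply: ccont_onM; first exact: ccont_on_cexp.
apply: ccont_onD; first exact: ccont_on_cst.
apply: ccont_onM; first exact: ccont_on_cst.
by apply: cint_itv_continuous (hi i); exact: ltW.
Qed.

Lemma green_class l c f : pieces_cont f ->
  exists u : L2Omega alpha beta, is_class_of u (pw (green l c f)).
Proof.
move=> fc; apply: pw_class => //; apply: green_cont => i.
by apply: ccont_on_integrable; apply: ccont_onM => //; exact: ccont_on_cexp.
Qed.

Lemma exp_sum_comb m (l : R[i]) (d : 'I_m -> R[i]) (c : 'I_m -> 'cV[R[i]]_n)
    (e : 'I_m -> L2Omega alpha beta) :
  (forall k, is_class_of (e k) (exp_sum alpha beta l (c k))) ->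
  is_class_of (\sum_k d k *: e k) (exp_sum alpha beta l (\sum_k d k *: c k)).
Proof.
move=> ec.
apply: is_class_of_ext (is_class_of_sum (index_enum _) (fun k => is_class_of_scale (d k) (ec k))) => s.
rewrite /exp_sum; under eq_bigr do rewrite mulr_sumr.
rewrite exchange_big/=; apply: eq_bigr => i _.
rewrite summxE !mulr_suml; apply: eq_bigr => k _.
by rewrite mxE !mulrA.
Qed.

(** The vectors [e k] come from the rows of a kernel matrix of size [n]; they span but may be
    dependent or zero. *)
Lemma exp_sum_span (l : R[i]) : exists e : 'I_n -> L2Omega alpha beta,
  [set u : L2Omega alpha beta | exists2 c, M l *m c = 0 & is_class_of u (exp_sum alpha beta l c)] =
  [set u : L2Omega alpha beta | exists d : 'I_n -> R[i], u = \sum_k d k *: e k].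
Proof.
pose K := kermx (M l)^T; pose ck k : 'cV[R[i]]_n := (row k K)^T.
have ck0 k : M l *m ck k = 0.
  by apply: trmx_inj; rewrite trmx_mul trmxK -row_mul mulmx_ker row0 trmx0.
have [e eP] : {e : 'I_n -> L2Omega alpha beta &
    forall k, is_class_of (e k) (exp_sum alpha beta l (ck k))}.
  apply: (@choice _ _ (fun k u => is_class_of u (exp_sum alpha beta l (ck k)))) => k.
  by rewrite exp_sumE; apply: pw_class => //; exact: exp_sum_cont.
exists e; apply/seteqP; split=> u /=.
  move=> [c c0 uc].
  have /submxP[D DE] : (c^T <= K)%MS by apply/sub_kermxP; rewrite -trmx_mul c0 trmx0.
  have cE : c = \sum_k D 0 k *: ck k.
    apply/colP => i; have /rowP/(_ i) := DE; rewrite !mxE summxE => ->.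
    by apply: eq_bigr => k _; rewrite !mxE.
  exists (D 0); apply: is_class_of_uniq uc _.
  by rewrite cE; exact: exp_sum_comb.
move=> [d ->]; exists (\sum_k d k *: ck k); last exact: exp_sum_comb.
by rewrite mulmx_sumr big1// => k _; rewrite -scalemxAr ck0 scaler0.
Qed.

Lemma kernel_graph l c u : M l *m c = 0 -> is_class_of u (exp_sum alpha beta l c) ->
  A (u, l *: u).
Proof. by move=> /Mlambda_kerP; exact: exp_sum_graph. Qed.

Hypothesis hA : self_adjoint L2ip A.

Lemma sa_sum (t : R[i]) m (d : 'I_m -> R[i]) (e : 'I_m -> L2Omega alpha beta) :
  (forall k, A (e k, t *: e k)) -> A (\sum_k d k *: e k, t *: \sum_k d k *: e k).
Proof.
move=> ke; apply: (big_ind (fun x => A (x, t *: x))).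
- by have [[A0 _ _] _ _] := hA; rewrite scaler0.
- by move=> x y Ax Ay; rewrite scalerDr; exact: (sa_add hA Ax Ay).
- move=> k _; have := sa_scale hA (d k) (ke k).
  by rewrite !scalerA [d k * t]mulrC.
Qed.

(* Orthogonality to the exponential sums is the solvability condition of the
   Fredholm alternative for the boundary system. *)
Lemma orthogonal_solvable (t : R) x : dom A x ->
  (forall c u, M t%:C *m c = 0 -> is_class_of u (exp_sum alpha beta t%:C c) ->
    L2ip x u = 0) ->
  exists y, A (y, x + t%:C *: y).
Proof.
move=> [_ [_ /= /(dom_B_pieces lt_alpha_beta lt_beta_alpha)[f fc xf]]] xperp.
pose k : 'cV[R[i]]_n := \col_i duhamel t%:C i (beta i) (f i).
have [c cE] : exists c, M t%:C *m c = - k.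
  apply: Mlambda_fredholm => // c c0.
  have [u uc] : exists u : L2Omega alpha beta, is_class_of u (exp_sum alpha beta t%:C c).
    by rewrite exp_sumE; apply: pw_class => //; exact: exp_sum_cont.
  have := ip_exp_sum fc xf uc; rewrite (xperp c u)// mulr0 => h.
  transitivity (- \sum_i duhamel t%:C i (beta i) (f i) * Num.conj (c i 0)).
    by rewrite -sumrN; apply: eq_bigr => i _; rewrite !mxE mulNr.
  by rewrite -h oppr0.
have [y yg] := green_class t%:C c fc.
exists y; apply: (green_graph lt_alpha_beta lt_beta_alpha fc xf _ _ yg); last first.
  by apply/Mlambda_mulP; exact: cE.
by move=> i; rewrite mxE.
Qed.

(** Projection onto the span of the sums [e k] is used twice. Let [w] be the residue of an
    eigenvector [u], and subtract from [x] in the domain its own projection, which stays in the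
    domain. The remainder is [(A - t) y] for some [y], and [<w, (A - t) y> = <(A - t) w, y> = 0].
    Since [w] is orthogonal to the span too, it is orthogonal to [x], and by density [w = 0]. *)
Lemma eigenspaceE (t : R) : [set u : L2Omega alpha beta | A (u, t%:C *: u)] =
  [set u : L2Omega alpha beta | exists2 c, M t%:C *m c = 0 & is_class_of u (exp_sum alpha beta t%:C c)].
Proof.
apply/seteqP; split=> u /=; last by move=> [c c0 uc]; exact: kernel_graph uc.
move=> Au; have [e eE] := exp_sum_span t%:C.
pose V := [set u : L2Omega alpha beta |
  exists2 c, M t%:C *m c = 0 & is_class_of u (exp_sum alpha beta t%:C c)].
have eV k : V (e k).
  rewrite /V eE; exists (fun j => (j == k)%:R).
  by rewrite (bigD1 k)//= eqxx scale1r big1 ?addr0// => j /negPf->; rewrite scale0r.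
have eA k : A (e k, t%:C *: e k) by have [c c0 ec] := eV k; exact: kernel_graph ec.
have spanA := fun d => sa_sum d eA.
have [d dP] := orthogonal_decomposition hip e u.
have subA x y d' : A (x, y) ->
    A (x - \sum_k d' k *: e k, y - t%:C *: \sum_k d' k *: e k).
  by move=> Ax; have := sa_linear hA (-1) (spanA d') Ax; rewrite !scaleN1r ![- _ + _]addrC.
suff w0 : u - \sum_k d k *: e k = 0.
  have : V u by rewrite /V eE; exists d; apply/eqP; rewrite -subr_eq0 w0.
  by [].
set w := u - _ in dP *.
have Aw : A (w, t%:C *: w) by have := subA _ _ d Au; rewrite -scalerBr.
apply: (dense_orthogonal hip (sa_dense hA)) => x [x' Ax].
have [b bP] := orthogonal_decomposition hip e x.
have Az := subA _ _ b Ax.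
have [y Ay] : exists y, A (y, (x - \sum_k b k *: e k) + t%:C *: y).
  apply: orthogonal_solvable; first by exists (x' - t%:C *: \sum_k b k *: e k).
  move=> c v c0 vc; have : V v by exists c.
  rewrite /V eE => -[a ->]; rewrite (ip_sumr hip) big1// => k _.
  by rewrite (ipZr hip) bP mulr0.
have := sa_sym hA Aw Ay.
rewrite (ipZl hip) (ipDr hip) (ipZr hip) conj_real.
move=> /eqP; rewrite -subr_eq0 opprD addrCA subrr addr0 oppr_eq0 (ipBr hip) => /eqP.
rewrite [X in _ - X](ip_sumr hip) big1 ?subr0// => k _.
by rewrite (ipZr hip) dP mulr0.
Qed.

Lemma eigenspace_finite_dimensional (t : R) :
  finite_dimensional [set u : L2Omega alpha beta | A (u, t%:C *: u)].
Proof.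
rewrite eigenspaceE; have [e ->] := exp_sum_span t%:C.
by exists n, e.
Qed.

End Eigenspaces.

(** * Resolvent and spectrum *)

Section Resolvent.
Context (R : realType) (n : nat).
Variables alpha beta : 'I_n -> R.
Hypothesis lt_alpha_beta : forall i, alpha i < beta i.
Hypothesis lt_beta_alpha : forall i j : 'I_n, (i < j)%N -> beta i < alpha j.
Variable B : 'M[R[i]]_n.
Implicit Types (i : 'I_n) (u v w : L2Omega alpha beta).
Local Notation J := (J alpha beta).
Local Notation mu := (mu_Omega alpha beta).
Local Notation pw := (pw alpha beta).
Local Notation pieces_cont := (pieces_cont alpha beta).
Local Notation hip := (@L2ip_inner_product _ (measurableTypeR R) R mu).
Local Notation A := (restriction (adjoint L2ip (opD alpha beta)) (dom_B B)).
Local Notation M := (Mlambda alpha beta B).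
Local Notation duhamel := (duhamel alpha).
Local Notation green := (green alpha).

Lemma measurable_cexp (z : R[i]) :
  measurable_fun setT (fun t : R => Re (cexp (z * t%:C))) /\
  measurable_fun setT (fun t : R => Im (cexp (z * t%:C))).
Proof.
have c (h dh : R -> R) : (forall x : R, is_derive x 1 h (dh x)) -> measurable_fun setT h.
  move=> hd; apply: continuous_measurable_fun => x.
  by apply: differentiable_continuous; apply/derivable1_diffP; case: (hd x).
have d x := is_cderive_cexp x z.
split; [apply: (c _ (fun x => Re (z * cexp (z * x%:C))))|
        apply: (c _ (fun x => Im (z * cexp (z * x%:C))))] => x; by case: (d x).
Qed.

Lemma measurable_cmul (f g : R -> R[i]) :
  measurable_fun setT (fun t => Re (f t)) /\ measurable_fun setT (fun t => Im (f t)) ->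
  measurable_fun setT (fun t => Re (g t)) /\ measurable_fun setT (fun t => Im (g t)) ->
  measurable_fun setT (fun t => Re (f t * g t)) /\
  measurable_fun setT (fun t => Im (f t * g t)).
Proof.
move=> [f1 f2] [g1 g2]; split.
  under eq_fun do rewrite ReM.
  by apply: measurable_funB; exact: measurable_funM.
under eq_fun do rewrite ImM.
by apply: measurable_funD; exact: measurable_funM.
Qed.

Lemma cint_itv_eq (a b : R) f g : measurable_fun setT (fun t => Re (g t)) ->
  measurable_fun setT (fun t => Im (g t)) ->
  (forall t, t \in `]a, b[ -> f t = g t) -> cint_itv a b f = cint_itv a b g.
Proof.
move=> g1 g2 fg.
have E (h k : R -> R) : measurable_fun setT k ->
    (forall t, t \in `]a, b[ -> h t = k t) ->
    \int[lebesgue_measure]_(x in `[a, b]) h x = \int[lebesgue_measure]_(x in `[a, b]) k x.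
  move=> mk hk.
  have mk' : measurable_fun `]a, b[ k by exact: measurable_funTS.
  have mh : measurable_fun `]a, b[ h.
    by apply: eq_measurable_fun mk' => t /set_mem ?; rewrite hk.
  have oo (p : R -> R) : measurable_fun `]a, b[ p ->
      (\int[lebesgue_measure]_(x in `[a, b]) (p x)%:E =
       \int[lebesgue_measure]_(x in `]a, b[) (p x)%:E)%E.
    by move=> mp; rewrite integral_itv_bndoo//; exact/measurable_EFinP.
  rewrite /Rintegral (oo _ mh) (oo _ mk').
  by congr fine; apply: eq_integral => t /set_mem ?; rewrite hk.
by apply: complex_eq; apply: E => // t /fg ->.
Qed.

Lemma phase_bounded (z : R[i]) (T : R) (S : set R) t : (forall s, S s -> `|s| <= T) ->
  normc ((\1_S t)%:C * cexp (z * t%:C)) <= expR (`|Re z| * T).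
Proof.
move=> ST; rewrite indicE; have [/set_mem St|_] := boolP (t \in S); last first.
  by rewrite mul0r normc0 expR_ge0.
rewrite mul1r normc_cexp ReM/= mulr0 subr0 ler_expR.
apply: le_trans (ler_norm _) _; rewrite normrM.
by apply: ler_wpM2l => //; exact: ST.
Qed.

Lemma phase_L2pred (z : R[i]) (T : R) (S : set (measurableTypeR R)) :
  measurable S -> (forall s, S s -> `|s| <= T) ->
  (fun t => (\1_S t)%:C * cexp (z * t%:C)) \in L2pred mu.
Proof.
move=> mS ST.
have [m1 m2] : measurable_fun setT (fun t : R => Re ((\1_S t)%:C * cexp (z * t%:C))) /\
    measurable_fun setT (fun t : R => Im ((\1_S t)%:C * cexp (z * t%:C))).
  apply: measurable_cmul (measurable_cexp z).
  by split; [exact: measurable_indic|exact: measurable_cst].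
by apply: (L2pred_bounded alpha beta m1 m2) => t; exact: (phase_bounded z t ST).
Qed.

Lemma conj_phaseE (z : R[i]) (t : R) :
  Num.conj (cexp (Num.conj z * t%:C)) = cexp (z * t%:C).
Proof. by rewrite conj_cexp conjM conjCK conj_real. Qed.

(** A product of two square integrable functions: the exponential is cut off to a bounded interval
    that contains all the endpoints. *)
Lemma duhamel_integrable l i w :
  cint_able (alpha i) (beta i) (fun s => cexp (- (twopii * l) * s%:C) * repr w s).
Proof.
have [T _ hT] := Omega_bounded alpha beta.
set z := - (twopii * l).
have eL : (fun t => (\1_`[-T, T] t)%:C * cexp (Num.conj z * t%:C)) \in L2pred mu.
  apply: (@phase_L2pred _ T); first exact: measurable_itv.
  by move=> s; rewrite /= in_itv/= ler_norml.
have := cintegrable_piece i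
  (@L2pred_mul _ (measurableTypeR R) R mu _ _ (repr_L2pred w) eL).
have E t : t \in `[alpha i, beta i]%classic ->
    repr w t * Num.conj ((\1_`[-T, T] t)%:C * cexp (Num.conj z * t%:C)) =
    cexp (z * t%:C) * repr w t.
  move=> /set_mem/=; rewrite in_itv/= => /andP[at_ tb].
  have [aT bT] := hT i.
  have -> : \1_`[-T, T] t = 1 :> R.
    rewrite indicE mem_set//= in_itv/=; apply/andP; split.
      by apply: le_trans at_; have := aT; rewrite ler_norml => /andP[].
    by apply: (le_trans tb); have := bT; rewrite ler_norml => /andP[].
  by rewrite mul1r conj_phaseE mulrC.
by move=> [i1 i2]; split; [apply: eq_integrable i1|apply: eq_integrable i2];
  rewrite ?measurable_itv// => t /E/= ->.
Qed.

(* [e i t] is the class of a truncated exponential; this makes the Duhamel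
   integral linear and bounded on [L2] classes. *)
Lemma duhamel_kernel l : exists2 K, 0 <= K & exists e : 'I_n -> R -> L2Omega alpha beta,
  (forall i t, hnorm L2ip (e i t) <= K) /\
  forall w f, f \in L2pred mu -> is_class_of w f -> forall i t, t <= beta i ->
    duhamel l i t f = L2ip w (e i t).
Proof.
have [T _ hT] := Omega_bounded alpha beta.
set z := - (twopii * l).
(* The minimum keeps the support inside one interval for every [t], so a single bound serves all the
   [e i t]. The exponent is conjugated because the scalar product conjugates its second argument. *)
pose phi (i : 'I_n) (t : R) (s : R) : R[i] :=
  (\1_`]alpha i, Num.min t (beta i)[ s)%:C * cexp (Num.conj z * s%:C).
have ST i t s : `]alpha i, Num.min t (beta i)[%classic s -> `|s| <= T.
  rewrite /= in_itv/= lt_min => /and3P[as_ _ sb].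
  have [aT bT] := hT i; rewrite ler_norml; apply/andP; split.
    by apply: le_trans (ltW as_); have := aT; rewrite ler_norml => /andP[].
  by apply: (le_trans (ltW sb)); have := bT; rewrite ler_norml => /andP[].
have phiL i t : phi i t \in L2pred mu.
  by apply: (@phase_L2pred _ T); [exact: measurable_itv|exact: ST].
have [e eP] : {e : 'I_n * R -> L2Omega alpha beta &
    forall p, is_class_of (e p) (phi p.1 p.2)}.
  apply: (@choice _ _ (fun p u => is_class_of u (phi p.1 p.2))) => p.
  exact: (@is_class_of_exists _ (measurableTypeR R) R mu _ (phiL p.1 p.2)).
pose K0 := expR (`|Re (Num.conj z)| * T) * Num.sqrt (fine (mu setT)).
have K0_ge0 : 0 <= K0 by rewrite mulr_ge0 ?expR_ge0 ?sqrtr_ge0.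
exists (normc twopii * K0); first by rewrite mulr_ge0 ?normc_ge0.
exists (fun i t => Num.conj twopii *: e (i, t)); split=> [i t|w f fL wf i t tb].
  rewrite (hnormZ hip) normcJ2 ler_wpM2l ?normc_ge0//.
  apply: (hnorm_bounded _ (phiL i t) (eP (i, t))).
    exact: expR_ge0.
  by move=> s; exact: (phase_bounded _ s (ST i t)).
rewrite (ipZr hip) conjCK; congr (twopii * _).
rewrite (@L2ip_class _ (measurableTypeR R) R mu w (e (i, t)) f _ fL (phiL i t) wf (eP (i, t))).
have [m1 m2] := measurable_cmul (measurable_cexp z)
  (@L2pred_measurable _ (measurableTypeR R) R mu f fL).
rewrite -(cint_indic alpha m1 m2 tb); congr cint; apply/funext => s.
by rewrite /phi min_l// conjM conj_real conj_phaseE [RHS]mulrCA [f s * _]mulrC.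
Qed.

Lemma pw_ext g h : (forall i t, J i t -> g i t = h i t) -> pw g = pw h.
Proof.
move=> gh; apply/funext => t; have [[i _ it]|Ot] := pselect (Omega alpha beta t).
  by rewrite !(pwE lt_beta_alpha _ it) gh.
by rewrite !pw_out.
Qed.

Lemma hnorm_sum I (r : seq I) (F : I -> L2Omega alpha beta) :
  hnorm L2ip (\sum_(k <- r) F k) <= \sum_(k <- r) hnorm L2ip (F k).
Proof.
elim: r => [|k r IH].
  by rewrite !big_nil /hnorm (ip0l hip) sqrtr0.
by rewrite !big_cons (le_trans (hnormD hip _ _))// lerD2l.
Qed.

(** Exponentials have no zero and every [J i] has positive measure. *)
Lemma exp_sum_eq0 l (c : 'cV[R[i]]_n) :
  is_class_of (0 : L2Omega alpha beta) (exp_sum alpha beta l c) -> c = 0.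
Proof.
rewrite exp_sumE => c0; apply/colP => i; rewrite mxE; apply/eqP/negPn/negP => ci.
have [N [mN N0 sN]] :=
  is_class_of_ae (is_class_of0 (mu : {measure set (measurableTypeR R) -> \bar R})) c0.
have mJ : measurable (J i : set (measurableTypeR R)) by exact: measurable_itv.
have JN : J i `<=` N.
  move=> t it; apply: sN => /=; rewrite (pwE lt_beta_alpha _ it) => /esym/eqP.
  rewrite mulf_eq0 (negbTE ci) orbF => /eqP /(congr1 (@normc R))/eqP.
  by rewrite normc_cexp normc0 gt_eqF ?expR_gt0.
have : (mu (J i) <= mu N)%E by apply: le_measure; rewrite ?inE.
rewrite N0 leNgt => /negP; apply.
rewrite /mu_Omega/= /mrestr setIidl; last by move=> t it; exists i.
by rewrite /J lebesgue_measure_itv/= lte_fin lt_alpha_beta -EFinB lte_fin subr_gt0.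
Qed.

Lemma green_operator l : M l \in unitmx ->
  exists (G : L2Omega alpha beta -> L2Omega alpha beta) (K : R),
    [/\ 0 <= K, forall v w, G (v - w) = G v - G w,
        forall w, hnorm L2ip (G w) <= K * hnorm L2ip w
      & forall w, dom A w -> A (G w, w + l *: G w)].
Proof.
move=> uM; have [K0 K0_ge0 [e [eK eP]]] := duhamel_kernel l.
pose N := invmx (M l).
(* The functional [w] to [c_i +] Duhamel integral, with [c] solving the boundary system, is the
   scalar product with [gv i t]. *)
pose gv i t := e i t + \sum_j Num.conj (- N i j) *: e j (beta j).
pose k w : 'cV[R[i]]_n := \col_j L2ip w (e j (beta j)).
pose c w := - (N *m k w).
pose phi w i t := cexp (twopii * l * t%:C) * L2ip w (gv i t).
have gvE w i t : L2ip w (gv i t) = c w i 0 + L2ip w (e i t).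
  rewrite (ipDr hip) addrC; congr (_ + _).
  rewrite (ip_sumr hip) !mxE -sumrN; apply: eq_bigr => j _.
  by rewrite (ipZr hip) conjCK mxE mulNr.
have phiE w f : f \in L2pred mu -> is_class_of w f ->
    pw (phi w) = pw (green l (c w) (fun=> f)).
  move=> fL wf; apply: pw_ext => i t; rewrite /J/= in_itv/= => /andP[_ tb].
  by rewrite /phi gvE /green (eP _ _ fL wf)// ltW.
have [G GP] : {G : L2Omega alpha beta -> L2Omega alpha beta &
    forall w, is_class_of (G w) (pw (phi w))}.
  apply: (@choice _ _ (fun w u => is_class_of u (pw (phi w)))) => w.
  rewrite (phiE w _ (repr_L2pred w) (is_class_of_repr w)).
  apply: pw_class => //; apply: green_cont => // i; exact: duhamel_integrable.
pose K1 := K0 + \sum_i \sum_j normc (N i j) * K0.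
have K1_ge0 : 0 <= K1.
  by rewrite addr_ge0// sumr_ge0// => i _; rewrite sumr_ge0// => j _; rewrite mulr_ge0// normc_ge0.
have gvK i t : hnorm L2ip (gv i t) <= K1.
  apply: le_trans (hnormD hip _ _) _; apply: lerD => //.
  apply: le_trans (hnorm_sum _ _) _.
  apply: (@le_trans _ _ (\sum_j normc (N i j) * K0)).
    apply: ler_sum => j _; rewrite (hnormZ hip) normcJ2 normcN.
    by rewrite ler_wpM2l ?normc_ge0.
  rewrite [leRHS](bigD1 i)//= lerDl sumr_ge0// => j _.
  by rewrite sumr_ge0// => m _; rewrite mulr_ge0// normc_ge0.
have [T T_gt0 hT] := Omega_bounded alpha beta.
pose X := expR (`|Re (twopii * l)| * T).
have X_ge0 : 0 <= X by exact: expR_ge0.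
have phiK w t : normc (pw (phi w) t) <= X * K1 * hnorm L2ip w.
  have [[i _ it]|Ot] := pselect (Omega alpha beta t); last first.
    by rewrite pw_out// normc0 !mulr_ge0 ?hnorm_ge0.
  rewrite (pwE lt_beta_alpha _ it) normcM -[X * K1 * _]mulrA; apply: ler_pM; rewrite ?normc_ge0//.
    have := @phase_bounded (twopii * l) T (J i) t; rewrite indicE mem_set// mul1r; apply.
    move=> s; rewrite /J/= in_itv/= => /andP[as_ sb].
    have [aT bT] := hT i; rewrite ler_norml; apply/andP; split.
      by apply: le_trans (ltW as_); have := aT; rewrite ler_norml => /andP[].
    by apply: (le_trans (ltW sb)); have := bT; rewrite ler_norml => /andP[].
  apply: le_trans (cauchy_schwarz hip _ _) _.
  by rewrite mulrC ler_wpM2r ?hnorm_ge0.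
exists G, (X * K1 * Num.sqrt (fine (mu setT))); split.
- by rewrite !mulr_ge0 ?sqrtr_ge0.
- move=> v w; apply: is_class_of_uniq (GP _) _.
  apply: is_class_of_ext (is_class_of_sub (GP v) (GP w)) => t.
  have /= <- := congr1 (fun F => F t)
    (@pw_op _ _ _ _ lt_beta_alpha (fun y z => y - z) (phi v) (phi w) (subr0 0)).
  congr (pw _ t); apply/funext => i; apply/funext => s.
  by rewrite /phi (ipBl hip) mulrBr.
- move=> w; rewrite mulrAC.
  have phiL : pw (phi w) \in L2pred mu.
    rewrite (phiE w _ (repr_L2pred w) (is_class_of_repr w)).
    apply: L2pred_pw => //; apply: green_cont => // i; exact: duhamel_integrable.
  apply: (hnorm_bounded _ phiL (GP w)) => //.
  by rewrite !mulr_ge0 ?hnorm_ge0.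
(* In the domain, continuous pieces replace the representative chosen by [repr], and [green_graph]
   applies. *)
move=> w [_ [_ /= /(dom_B_pieces lt_alpha_beta lt_beta_alpha)[f fc wf]]].
have fL := L2pred_pw lt_beta_alpha fc.
have duhE i t : t <= beta i -> duhamel l i t (pw f) = duhamel l i t (f i).
  move=> tb; congr (twopii * _); apply/esym/cint_itv_eq.
  - exact: (measurable_cmul (measurable_cexp _) (measurable_pw fc)).1.
  - exact: (measurable_cmul (measurable_cexp _) (measurable_pw fc)).2.
  move=> s; rewrite in_itv/= => /andP[as_ st]; congr (_ * _).
  rewrite (pwE lt_beta_alpha _ (_ : J i s))//.
  by rewrite /J/= in_itv/= as_ (lt_le_trans st tb).
apply: (green_graph lt_alpha_beta lt_beta_alpha (c := c w) (k := k w) fc wf).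
- by move=> i; rewrite mxE -(eP _ _ fL wf)// duhE.
- by apply/Mlambda_mulP; rewrite /c mulmxN mulKVmx.
have := GP w; rewrite (phiE w _ fL wf); congr is_class_of.
apply: pw_ext => i t; rewrite /J/= in_itv/= => /andP[_ tb].
by rewrite /green duhE// ltW.
Qed.

Hypothesis uB : B \is unitarymx.
Hypothesis hA : self_adjoint L2ip A.

(** For [(a, b)] in the graph, [F w = <b, G w> - <a, w + l G w>] is additive and bounded, and zero
    on the domain by symmetry. By density it is zero everywhere, so every pair [(G w, w + l G w)]
    lies in [adjoint A = A]. *)
Lemma resolvent_operator l : M l \in unitmx ->
  exists (G : L2Omega alpha beta -> L2Omega alpha beta) (K : R),
    (forall w, hnorm L2ip (G w) <= K * hnorm L2ip w) /\
    forall w, A (G w, w + l *: G w).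
Proof.
move=> /green_operator[G [K [K0 GB GK GA]]].
exists G, K; split=> // w; have [_ dA adjA] := hA; rewrite -adjA => a b Aab /=.
pose F w : R[i] := L2ip b (G w) - L2ip a (w + l *: G w).
have fB v v' : F (v - v') = F v - F v'.
  by rewrite /F GB scalerBr !(ipDr hip) !(ipNr hip); ring.
have fK v : normc (F v) <=
    (hnorm L2ip b * K + hnorm L2ip a * (1 + normc l * K)) * hnorm L2ip v.
  apply: le_trans (le_normcD _ _) _.
  rewrite normcN mulrDl; apply: lerD.
    by rewrite (le_trans (cauchy_schwarz hip _ _))// -mulrA ler_wpM2l ?hnorm_ge0.
  rewrite (le_trans (cauchy_schwarz hip _ _))// -mulrA ler_wpM2l ?hnorm_ge0//.
  rewrite mulrDl mul1r (le_trans (hnormD hip _ _))// lerD2l (hnormZ hip) -mulrA.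
  by rewrite ler_wpM2l ?normc_ge0.
have F0 v : dom A v -> F v = 0 by move=> /GA Av; rewrite /F (sa_sym hA Aab Av) subrr.
have Fw := antilinear_dense dA fB fK F0 w.
by apply/eqP; rewrite -subr_eq0; apply/eqP; rewrite -[LHS]/(F w).
Qed.

(** Off [Lambda_B], [G] is a right inverse of [A - l]. Injectivity comes from the conjugate point,
    which is off [Lambda_B] too since that set is real: if [A d = l d], then
    [<d, w> = <d, (A - conj l) (G' w)> = 0] for all [w]. On [Lambda_B] a kernel vector yields a
    nonzero eigenvector. *)
Lemma spectrumE : spectrum L2ip A = Lambda_B alpha beta B.
Proof.
have realL := Lambda_B_real lt_alpha_beta uB.
apply/seteqP; split=> l; last first.
  move=> /Lambda_BP[c c0 Mc].
  have [u uc] : exists u : L2Omega alpha beta, is_class_of u (exp_sum alpha beta l c).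
    by rewrite exp_sumE; apply: pw_class => //; exact: exp_sum_cont.
  apply: (eigen_spectrum hip (kernel_graph lt_alpha_beta lt_beta_alpha Mc uc)).
  by move=> u0; move/eqP: c0; apply; apply: (@exp_sum_eq0 l); rewrite -u0.
apply: contra_notP => nL.
have unit z : ~ Lambda_B alpha beta B z -> M z \in unitmx.
  by move=> nz; rewrite unitmxE unitfE; apply/eqP.
have nLc : ~ Lambda_B alpha beta B (Num.conj l).
  move=> /[dup] /realL lE; suff -> : Num.conj l = l by [].
  by rewrite -[in RHS](conjCK l) lE conj_real.
have [G [K [GK GA]]] := resolvent_operator (unit _ nL).
have [G' [_ [_ GA']]] := resolvent_operator (unit _ nLc).
have inj d : A (d, l *: d) -> d = 0.
  move=> Ad; have dd w : L2ip d w = 0.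
    have := sa_sym hA Ad (GA' w).
    rewrite (ipZl hip) (ipDr hip) (ipZr hip) conjCK => /eqP.
    by rewrite eq_sym -subr_eq0 addrK => /eqP.
  by apply: (ip_eq0 hip); rewrite dd.
have GE u v : A (u, v) -> u = G (v - l *: u).
  move=> Au; apply/eqP; rewrite -subr_eq0; apply/eqP; apply: inj.
  have := sa_linear hA (-1) (GA (v - l *: u)) Au; rewrite !scaleN1r addrC.
  congr (A (_, _)); rewrite addrC opprD opprB scalerBr addrA [v + _]addrC.
  by rewrite addrCA subrr addr0.
split=> [w|].
  exists (G w); split.
    by exists (w + l *: G w); rewrite ?addrK//; exact: GA.
  by move=> u [v Au wE]; rewrite -wE -GE.
exists K => u v Au; rewrite {1}(GE _ _ Au); exact: GK.
Qed.

End Resolvent.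

(** Since [P] is indexed by sets of reals, the projection at [l] is written [P [set Re l]]; the
    clause [l = (Re l)%:C] says that this is the atom at [l] itself. *)
Theorem theorem3p15 (R : realType) (n : nat) (n_gt0 : (0 < n)%N)
    (alpha beta : 'I_n -> R)
    (lt_alpha_beta : forall i, alpha i < beta i)
    (lt_beta_alpha : forall i j : 'I_n, (i < j)%N -> beta i < alpha j)
    (A : set (L2Omega alpha beta * L2Omega alpha beta))
    (A_ext : self_adjoint_extension L2ip (opD alpha beta) A)
    (B : 'M[R[i]]_n) (A_B : associated_matrix A B)
    (P : set R -> L2Omega alpha beta -> L2Omega alpha beta)
    (A_P : spectral_measure_of L2ip A P) :
  [/\ atomic P,
      supported_on P (Lambda_B alpha beta B),
      spectrum L2ip A = Lambda_B alpha beta B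
    & forall l : R[i], Lambda_B alpha beta B l ->
      [/\ l = (Re l)%:C,
          finite_dimensional (range (P [set Re l]))
        & range (P [set Re l]) =
          [set u : L2Omega alpha beta | exists2 c : 'cV[R[i]]_n,
             Mlambda alpha beta B l *m c = 0
           & is_class_of u (exp_sum alpha beta l c)]]].
Proof.
have [uB AE] := A_B; have [hA _] := A_ext; subst A.
have hip := @L2ip_inner_product _ (measurableTypeR R) R (mu_Omega alpha beta).
have sE := spectrumE lt_alpha_beta lt_beta_alpha uB hA.
have cL : countable [set t : R | spectrum L2ip
    (restriction (adjoint L2ip (opD alpha beta)) (dom_B B)) t%:C].
  by rewrite sE; exact: countable_Lambda_B.
split=> //.
- exact: (pvm_atomic hip hA A_P cL).
- by rewrite -sE; exact: (pvm_supported hip hA A_P cL).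
move=> l Ll; have lE := Lambda_B_real lt_alpha_beta uB Ll.
rewrite (range_pvm_set1 hip hA A_P); split=> //.
  exact: eigenspace_finite_dimensional.
by rewrite [in RHS]lE; exact: eigenspaceE.
Qed.
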